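(* Let $K$ be an algebraically closed field. For all integers $m \geq 1$ and $d_0, d_1 \geq 0$, the variety $\mathcal{X}_m(d_0,d_1)$ has a unique dense $G_{d_0,d_1}$-orbit.
   Context: $K$ is an algebraically closed field; varieties carry the Zariski topology. For $m \geq 1$ and $d_0, d_1 \geq 0$, $\mathcal{X}_m(d_0,d_1)$ is the affine variety consisting of the triples $M = (M_0, M_1, h_M)$, where $M_0$ is a $(d_0 \times d_0)$-matrix, $M_1$ is a $(d_1 \times d_1)$-matrix and $h_M$ is a $(d_0 \times d_1)$-matrix, all with entries in $K$, such that $M_0^m = 0$, $M_1^m = 0$ and $M_0 h_M = h_M M_1$. By convention, if $d', d'' \geq 0$ and $d' = 0$ or $d'' = 0$, then there is a unique $(d' \times d'')$-matrix, which behaves like zero with respect to multiplication. The group $G_{d_0,d_1} := \mathrm{GL}_{d_0}(K) \times \mathrm{GL}_{d_1}(K)$ acts on $\mathcal{X}_m(d_0,d_1)$ by $(g_0, g_1) \cdot (M_0, M_1, h_M) := (g_0 M_0 g_0^{-1}, g_1 M_1 g_1^{-1}, g_0 h_M g_1^{-1})$. *)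

(* Defs.v *)
From HB Require Import structures.
From mathcomp Require Import all_boot all_order all_algebra.
From mathcomp Require Import boolp classical_sets topology.
(* The notations of mpoly clash with those of MathComp-Analysis. *)
From mathcomp Require Import -(notations) mpoly.

Set Implicit Arguments.
Unset Strict Implicit.
Unset Printing Implicit Defensive.

Import GRing.Theory.
Local Open Scope classical_set_scope.
Local Open Scope ring_scope.

Definition triple (K : closedFieldType) (d0 d1 : nat) : Type :=
  'M[K]_d0 * 'M[K]_d1 * 'M[K]_(d0, d1).

Definition in_variety (K : closedFieldType) (m d0 d1 : nat) :
    pred (triple K d0 d1) :=
  fun M => let: (M0, M1, h) := M in
  [&& M0 ^+ m == 0, M1 ^+ m == 0 & M0 *m h == h *m M1].

Definition variety (K : closedFieldType) (m d0 d1 : nat) : Type :=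
  {M : triple K d0 d1 | in_variety m M}.

HB.instance Definition _ (K : closedFieldType) (m d0 d1 : nat) :=
  Choice.on (variety K m d0 d1).

(* The list of all matrix entries: a triple is a point of the affine space of
   dimension d0 * d0 + d1 * d1 + d0 * d1. *)
Definition coords (K : closedFieldType) (d0 d1 : nat) (M : triple K d0 d1) :
    'rV[K]_(d0 * d0 + d1 * d1 + d0 * d1) :=
  let: (M0, M1, h) := M in row_mx (row_mx (mxvec M0) (mxvec M1)) (mxvec h).

Definition poly_eval (K : closedFieldType) (d0 d1 : nat)
    (p : mpoly (d0 * d0 + d1 * d1 + d0 * d1) K) (M : triple K d0 d1) : K :=
  meval (fun i => coords M 0 i) p.

Definition zero_locus (K : closedFieldType) (m d0 d1 : nat)
    (S : set (mpoly (d0 * d0 + d1 * d1 + d0 * d1) K)) :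
    set (variety K m d0 d1) :=
  [set M | forall p, S p -> poly_eval p (\val M) = 0].

Definition zariski_open (K : closedFieldType) (m d0 d1 : nat) :
    set (set (variety K m d0 d1)) :=
  [set U | exists S, U = ~` zero_locus S].

Lemma zariski_openT (K : closedFieldType) (m d0 d1 : nat) :
  zariski_open [set: variety K m d0 d1].
Proof.
exists [set p | p = 1]; apply/seteqP; split=> // M _ /= /(_ 1 erefl)/eqP.
by rewrite /poly_eval rmorph1 oner_eq0.
Qed.

Lemma zariski_openI (K : closedFieldType) (m d0 d1 : nat) :
  setI_closed (@zariski_open K m d0 d1).
Proof.
move=> _ _ [S ->] [T ->].
exists [set r | exists p q, [/\ S p, T q & r = p * q]].
rewrite -setCU; congr (~` _); apply/seteqP; split=> [M|M /=].
  move=> MST _ [p [q [Sp Tq ->]]]; rewrite /poly_eval rmorphM /=.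
  by case: MST => [/(_ p Sp)|/(_ q Tq)]; rewrite /poly_eval => ->;
    rewrite ?mul0r ?mulr0.
move=> MST; case: (pselect (zero_locus S M)) => [|nS]; [by left | right].
move=> q Tq; have [p Sp pM] : exists2 p, S p & poly_eval p (\val M) != 0.
  apply: contrapT => nex; apply: nS => p Sp; apply/eqP.
  by apply: contrapT => /negP npM; apply: nex; exists p.
have /MST : exists p' q', [/\ S p', T q' & p * q = p' * q'] by exists p, q.
by rewrite /poly_eval rmorphM => /eqP; rewrite mulf_eq0 (negPf pM) => /eqP.
Qed.

Lemma zariski_open_bigcup (K : closedFieldType) (m d0 d1 : nat) (I : Type)
    (f : I -> set (variety K m d0 d1)) :
  (forall i, zariski_open (f i)) -> zariski_open (\bigcup_i f i).
Proof.
move=> /choice[S fE]; exists (\bigcup_i S i).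
rewrite (eq_bigcupr (fun i _ => fE i)) -setC_bigcap; congr (~` _).
apply/seteqP; split=> [M MS p [i _ Sp]|M MS i _ p Sp]; first exact: (MS i).
by apply: MS; exists i.
Qed.

HB.instance Definition _ (K : closedFieldType) (m d0 d1 : nat) :=
  isOpenTopological.Build (variety K m d0 d1)
    (@zariski_openT K m d0 d1) (@zariski_openI K m d0 d1)
    (@zariski_open_bigcup K m d0 d1).

Definition act (K : closedFieldType) (d0 d1 : nat) (g0 : 'M[K]_d0)
    (g1 : 'M[K]_d1) (M : triple K d0 d1) : triple K d0 d1 :=
  let: (M0, M1, h) := M in
  (g0 *m M0 *m invmx g0, g1 *m M1 *m invmx g1, g0 *m h *m invmx g1).

Lemma act_in_variety (K : closedFieldType) (m d0 d1 : nat) (g0 : 'M[K]_d0)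
    (g1 : 'M[K]_d1) (M : triple K d0 d1) :
  g0 \in unitmx -> g1 \in unitmx -> in_variety m M -> in_variety m (act g0 g1 M).
Proof.
have conjX d (g A : 'M[K]_d) : g \in unitmx ->
    (g *m A *m invmx g) ^+ m = g *m A ^+ m *m invmx g.
  move=> gu; elim: m => [|n IHn]; first by rewrite !expr0 mulmx1 mulmxV.
  by rewrite !exprS IHn -!mulmxE !mulmxA mulmxKV.
case: M => [[M0 M1] h] u0 u1 /and3P[/eqP E0 /eqP E1 /eqP Eh].
rewrite /in_variety /= !conjX // E0 E1 !mulmx0 !mul0mx !eqxx /=.
by rewrite !mulmxA !mulmxKV // -(mulmxA g0) Eh !mulmxA.
Qed.

Definition GL_orbit (K : closedFieldType) (m d0 d1 : nat)
    (M : variety K m d0 d1) : set (variety K m d0 d1) :=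
  [set N | exists (g0 : 'M[K]_d0) (g1 : 'M[K]_d1),
     [/\ g0 \in unitmx, g1 \in unitmx & \val N = act g0 g1 (\val M)]].

(* Main.v *)
Require Import Defs.
From mathcomp Require Import all_boot all_order all_algebra.
From mathcomp Require Import boolp classical_sets topology.
From mathcomp Require Import -(notations) mpoly.
From mathcomp Require Import zify.

(* A point of the variety is a homomorphism h from N1 to N0 of modules over
   K[x]/(x^m). A closed set containing the points of a polynomial curve with t != 0
   contains the point t = 0, and by induction on m and on d0 + d1 this shows that
   every point degenerates from a single G. Put P = K[x]/(x^m), which is injective.
   - If x^(m-1) N0 != 0, then P splits off N0 and the rest of the point is governed
     by the dimensions (d0 - m, d1); the component N1 -> P of h is a linear form on
     N1, which can be moved to a general one or to 0.
   - If x^(m-1) kills N0 and N1, the point lies in the variety for m - 1, so by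
     induction it may be replaced by a general point there. When 0 < d1 < d0, then
     h is injective and M0 is an extension [A B; 0 E]; the class B can be moved
     along a line until x^(m-1) N0 != 0. If d1 = 0, the same is done with a
     decomposition of N0. If d1 = d0, then h is invertible and only the matrix M0
     matters; d1 > d0 follows by duality.
   A dense orbit is open, by semicontinuity of Hom(G, -), hence it meets any other
   dense orbit. *)

Set Implicit Arguments.
Unset Strict Implicit.
Unset Printing Implicit Defensive.

Import GRing.Theory.
Local Open Scope ring_scope.
Local Arguments in_variety : simpl never.

(** * Polynomial functions and closures *)

Section PolynomialFunctions.
Variables (K : closedFieldType) (T : Type) (B : (T -> K) -> Prop).

(** The algebra of functions generated by [B]. Keeping [B] abstract lets one notion serve the affine
    line and all spaces of triples, and makes composition with a polynomial map a plain
    induction. *)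
Inductive polyfun : (T -> K) -> Prop :=
| polyfun_base f : B f -> polyfun f
| polyfun_cst c : polyfun (fun=> c)
| polyfun_add f g : polyfun f -> polyfun g -> polyfun (fun x => f x + g x)
| polyfun_mul f g : polyfun f -> polyfun g -> polyfun (fun x => f x * g x).

Definition polyfun_mx a b (F : T -> 'M[K]_(a, b)) :=
  forall i j, polyfun (fun x => F x i j).

Definition zclosure (S : T -> Prop) (x : T) :=
  forall p, polyfun p -> (forall y, S y -> p y = 0) -> p x = 0.

Lemma eq_polyfun f g : f =1 g -> polyfun f -> polyfun g.
Proof. by move/funext ->. Qed.

Lemma polyfun_sum (I : Type) (r : seq I) (P : pred I) (f : I -> T -> K) :
  (forall i, polyfun (f i)) -> polyfun (fun x => \sum_(i <- r | P i) f i x).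
Proof.
move=> pf; elim: r => [|i r IHr].
  by apply: eq_polyfun (polyfun_cst 0) => x; rewrite big_nil.
case Pi: (P i); last by apply: eq_polyfun IHr => x; rewrite big_cons Pi.
by apply: eq_polyfun (polyfun_add (pf i) IHr) => x; rewrite big_cons Pi.
Qed.

Lemma polyfun_prod (I : Type) (r : seq I) (P : pred I) (f : I -> T -> K) :
  (forall i, polyfun (f i)) -> polyfun (fun x => \prod_(i <- r | P i) f i x).
Proof.
move=> pf; elim: r => [|i r IHr].
  by apply: eq_polyfun (polyfun_cst 1) => x; rewrite big_nil.
case Pi: (P i); last by apply: eq_polyfun IHr => x; rewrite big_cons Pi.
by apply: eq_polyfun (polyfun_mul (pf i) IHr) => x; rewrite big_cons Pi.
Qed.

Lemma polyfun_exp f k : polyfun f -> polyfun (fun x => f x ^+ k).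
Proof.
move=> pf; elim: k => [|k IHk].
  by apply: eq_polyfun (polyfun_cst 1) => x; rewrite expr0.
by apply: eq_polyfun (polyfun_mul pf IHk) => x; rewrite exprS.
Qed.

Lemma polyfun_mx_cst a b (A : 'M[K]_(a, b)) : polyfun_mx (fun=> A).
Proof. by move=> i j; apply: polyfun_cst. Qed.

Lemma polyfun_mx_add a b (F G : T -> 'M[K]_(a, b)) :
  polyfun_mx F -> polyfun_mx G -> polyfun_mx (fun x => F x + G x).
Proof.
move=> pF pG i j.
by apply: eq_polyfun (polyfun_add (pF i j) (pG i j)) => x; rewrite !mxE.
Qed.

Lemma polyfun_mx_scale a b (f : T -> K) (F : T -> 'M[K]_(a, b)) :
  polyfun f -> polyfun_mx F -> polyfun_mx (fun x => f x *: F x).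
Proof.
move=> pf pF i j.
by apply: eq_polyfun (polyfun_mul pf (pF i j)) => x; rewrite !mxE.
Qed.

Lemma polyfun_mx_sub a b (F G : T -> 'M[K]_(a, b)) :
  polyfun_mx F -> polyfun_mx G -> polyfun_mx (fun x => F x - G x).
Proof.
move=> pF pG i j.
have pN := polyfun_mul (polyfun_cst (-1)) (pG i j).
by apply: eq_polyfun (polyfun_add (pF i j) pN) => x; rewrite !mxE mulN1r.
Qed.

Lemma polyfun_mx_mul a b c (F : T -> 'M[K]_(a, b)) (G : T -> 'M[K]_(b, c)) :
  polyfun_mx F -> polyfun_mx G -> polyfun_mx (fun x => F x *m G x).
Proof.
move=> pF pG i j.
apply: (@eq_polyfun (fun x => \sum_k F x i k * G x k j)).
  by move=> x; rewrite mxE.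
by apply: polyfun_sum => k; apply: polyfun_mul.
Qed.

Lemma polyfun_mx_exp a (F : T -> 'M[K]_a) k :
  polyfun_mx F -> polyfun_mx (fun x => F x ^+ k).
Proof.
move=> pF; elim: k => [|k IHk] i j.
  by apply: eq_polyfun (polyfun_cst ((1%:M : 'M[K]_a) i j)) => x.
apply: eq_polyfun (polyfun_mx_mul pF IHk i j) => x.
by rewrite exprS -mulmxE.
Qed.

Lemma polyfun_mx_row a b1 b2 (F : T -> 'M[K]_(a, b1)) (G : T -> 'M[K]_(a, b2)) :
  polyfun_mx F -> polyfun_mx G -> polyfun_mx (fun x => row_mx (F x) (G x)).
Proof.
move=> pF pG i j; case: (split_ordP j) => k ->.
  by apply: eq_polyfun (pF i k) => x; rewrite row_mxEl.
by apply: eq_polyfun (pG i k) => x; rewrite row_mxEr.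
Qed.

Lemma polyfun_mx_col a1 a2 b (F : T -> 'M[K]_(a1, b)) (G : T -> 'M[K]_(a2, b)) :
  polyfun_mx F -> polyfun_mx G -> polyfun_mx (fun x => col_mx (F x) (G x)).
Proof.
move=> pF pG i j; case: (split_ordP i) => k ->.
  by apply: eq_polyfun (pF k j) => x; rewrite col_mxEu.
by apply: eq_polyfun (pG k j) => x; rewrite col_mxEd.
Qed.

Lemma polyfun_mx_block a1 a2 b1 b2 (F : T -> 'M[K]_(a1, b1))
    (G : T -> 'M[K]_(a1, b2)) (H : T -> 'M[K]_(a2, b1)) (L : T -> 'M[K]_(a2, b2)) :
  polyfun_mx F -> polyfun_mx G -> polyfun_mx H -> polyfun_mx L ->
  polyfun_mx (fun x => block_mx (F x) (G x) (H x) (L x)).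
Proof.
by move=> pF pG pH pL; apply: polyfun_mx_col; apply: polyfun_mx_row.
Qed.

Lemma polyfun_mx_tr a b (F : T -> 'M[K]_(a, b)) :
  polyfun_mx F -> polyfun_mx (fun x => (F x)^T).
Proof. by move=> pF i j; apply: eq_polyfun (pF j i) => x; rewrite mxE. Qed.

Lemma polyfun_det a (F : T -> 'M[K]_a) :
  polyfun_mx F -> polyfun (fun x => \det (F x)).
Proof.
move=> pF; apply: polyfun_sum => s; apply: polyfun_mul; first exact: polyfun_cst.
by apply: polyfun_prod => i.
Qed.

Lemma polyfun_mx_adj a (F : T -> 'M[K]_a) :
  polyfun_mx F -> polyfun_mx (fun x => \adj (F x)).
Proof.
move=> pF i j.
apply: (@eq_polyfun (fun x => (-1) ^+ (j + i) * \det (row' j (col' i (F x))))).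
  by move=> x; rewrite mxE.
apply: polyfun_mul; first exact: polyfun_cst.
apply: polyfun_det => k l.
by apply: eq_polyfun (pF (lift j k) (lift i l)) => x; rewrite !mxE.
Qed.

Lemma zclosure_id S x : S x -> zclosure S x.
Proof. by move=> Sx p _; apply. Qed.

Lemma polyfun_mx_neq0 a b (F : T -> 'M[K]_(a, b)) x :
  polyfun_mx F -> F x != 0 ->
  exists q, [/\ polyfun q, q x != 0 & forall y, q y != 0 -> F y != 0].
Proof.
move=> pF Fx0.
have [i [j Fij]] : exists i j, F x i j != 0.
  apply: contrapT => nF; case/eqP: Fx0; apply/matrixP => i j; rewrite mxE.
  by apply/eqP; apply: contrapT => /negP Fij; apply: nF; exists i, j.
exists (fun y => F y i j); split=> // y; apply: contraNneq => ->.
by rewrite mxE.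
Qed.

(** An open condition satisfied at one point of the closure is met somewhere on [S]. In this way a
    single explicit point of the variety forces open properties on a generic orbit. *)
Lemma zclosure_neq0 S x q : zclosure S x -> polyfun q -> q x != 0 ->
  exists2 y, S y & q y != 0.
Proof.
move=> Sx pq qx0; apply: contrapT => nS; case/eqP: qx0; apply: Sx => // y Sy.
by apply/eqP; apply: contrapT => /negP qy; apply: nS; exists y.
Qed.

End PolynomialFunctions.

Lemma polyfun_comp (K : closedFieldType) (T T' : Type) (B : (T -> K) -> Prop)
    (B' : (T' -> K) -> Prop) (phi : T' -> T) f :
  (forall g, B g -> polyfun B' (fun x => g (phi x))) ->
  polyfun B f -> polyfun B' (fun x => f (phi x)).
Proof.
move=> Bphi; elim=> {f} [f /Bphi //|c|f g _ pf _ pg|f g _ pf _ pg].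
- exact: polyfun_cst.
- exact: polyfun_add pf pg.
- exact: polyfun_mul pf pg.
Qed.

Lemma zclosure_map (K : closedFieldType) (T T' : Type) (B : (T -> K) -> Prop)
    (B' : (T' -> K) -> Prop) (phi : T' -> T) (S : T -> Prop) (S' : T' -> Prop) x :
  (forall g, B g -> polyfun B' (fun x => g (phi x))) ->
  (forall y, S' y -> zclosure B S (phi y)) ->
  zclosure B' S' x -> zclosure B S (phi x).
Proof.
move=> Bphi S'S S'x p pp pS; apply: (S'x _ (polyfun_comp Bphi pp)) => y /S'S.
exact.
Qed.

Definition is_id (K : Type) (f : K -> K) := f = id.

Lemma polyfun_line (K : closedFieldType) (f : K -> K) :
  polyfun (@is_id K) f -> exists p : {poly K}, forall t, f t = p.[t].
Proof.
elim=> {f} [_ ->|c|f g _ [p fE] _ [q gE]|f g _ [p fE] _ [q gE]].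
- by exists 'X => t; rewrite hornerX.
- by exists c%:P => t; rewrite hornerC.
- by exists (p + q) => t; rewrite hornerD fE gE.
- by exists (p * q) => t; rewrite hornerM fE gE.
Qed.

(** An algebraically closed field is infinite: if [p != 0], then [p * 'X] has a non-root, which is a
    nonzero point where [f] does not vanish. *)
Lemma zclosure_line (K : closedFieldType) (t : K) :
  zclosure (@is_id K) (fun t => t != 0) t.
Proof.
move=> f /polyfun_line[p fE] f0; rewrite fE.
have [->|p_neq0] := eqVneq p 0; first by rewrite horner0.
have /closed_nonrootP[u] : p * 'X != 0 by rewrite mulf_neq0 ?polyX_eq0.
rewrite rootM negb_or /root hornerX => /andP[pu u0].
by case/eqP: pu; rewrite -fE f0.
Qed.

(** * Isomorphism and degeneration of triples *)

Section Triples.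
Variable K : closedFieldType.
Implicit Types (m d e a b c : nat).

Lemma exprS_mx d (M : 'M[K]_d) k : M ^+ k.+1 = M *m M ^+ k.
Proof. by rewrite exprS -mulmxE. Qed.

Lemma exprSr_mx d (M : 'M[K]_d) k : M ^+ k.+1 = M ^+ k *m M.
Proof. by rewrite exprSr -mulmxE. Qed.

Lemma exprD_mx d (M : 'M[K]_d) k l : M ^+ (k + l) = M ^+ k *m M ^+ l.
Proof. by rewrite exprD -mulmxE. Qed.

Lemma expr_mx_eq0 d (M : 'M[K]_d) k l : (k <= l)%N -> M ^+ k = 0 -> M ^+ l = 0.
Proof. by move=> /subnKC <- Mk0; rewrite exprD_mx Mk0 mul0mx. Qed.

Lemma trmx_exp d (M : 'M[K]_d) k : (M ^+ k)^T = M^T ^+ k.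
Proof.
elim: k => [|k IHk]; first by rewrite !expr0 trmx1.
by rewrite exprS_mx trmx_mul IHk exprSr_mx.
Qed.

Lemma intertwine_exp d e (Y : 'M[K]_e) (X : 'M[K]_d) (g : 'M[K]_(e, d)) k :
  Y *m g = g *m X -> Y ^+ k *m g = g *m X ^+ k.
Proof.
move=> YgX; elim: k => [|k IHk]; first by rewrite !expr0 mul1mx mulmx1.
by rewrite exprSr_mx -mulmxA YgX mulmxA IHk -mulmxA -exprSr_mx.
Qed.

Lemma in_varietyP m d0 d1 (X : triple K d0 d1) :
  reflect [/\ X.1.1 ^+ m = 0, X.1.2 ^+ m = 0 & X.1.1 *m X.2 = X.2 *m X.1.2]
          (in_variety m X).
Proof.
case: X => [[M0 M1] h] /=.
apply: (iffP and3P) => [[/eqP-> /eqP-> /eqP->]|[-> -> ->]] //.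
Qed.

(* Compared with [act], the dimensions of both sides may be only propositionally
   equal, which avoids casts along [d = m + d']. *)
Definition iso d0 d1 e0 e1 (X : triple K d0 d1) (Y : triple K e0 e1) :=
  exists (g0 : 'M[K]_(e0, d0)) (g0' : 'M[K]_(d0, e0))
         (g1 : 'M[K]_(e1, d1)) (g1' : 'M[K]_(d1, e1)),
   [/\ g0 *m g0' = 1%:M, g0' *m g0 = 1%:M, g1 *m g1' = 1%:M & g1' *m g1 = 1%:M]
   /\ [/\ Y.1.1 *m g0 = g0 *m X.1.1, Y.1.2 *m g1 = g1 *m X.1.2
        & Y.2 *m g1 = g0 *m X.2].

Lemma iso_refl d0 d1 (X : triple K d0 d1) : iso X X.
Proof.
by exists 1%:M, 1%:M, 1%:M, 1%:M; split; split; rewrite ?mul1mx ?mulmx1.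
Qed.

Lemma intertwine_inv d e d' e' (g : 'M[K]_(e, d)) (g' : 'M[K]_(d, e))
    (l : 'M[K]_(e', d')) (l' : 'M[K]_(d', e'))
    (X : 'M[K]_(d, d')) (Y : 'M[K]_(e, e')) :
  g' *m g = 1%:M -> l *m l' = 1%:M -> Y *m l = g *m X -> X *m l' = g' *m Y.
Proof.
move=> g'g ll' YlX; rewrite -[X]mul1mx -g'g -(mulmxA g') -YlX.
by rewrite -!mulmxA ll' mulmx1.
Qed.

Lemma iso_sym d0 d1 e0 e1 (X : triple K d0 d1) (Y : triple K e0 e1) :
  iso X Y -> iso Y X.
Proof.
case=> g0 [g0' [g1 [g1' [[E1 E2 E3 E4] [F1 F2 F3]]]]].
exists g0', g0, g1', g1; split; split=> //.
- exact: intertwine_inv F1.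
- exact: intertwine_inv F2.
- exact: intertwine_inv F3.
Qed.

Lemma iso_trans d0 d1 e0 e1 c0 c1 (X : triple K d0 d1) (Y : triple K e0 e1)
    (Z : triple K c0 c1) : iso X Y -> iso Y Z -> iso X Z.
Proof.
case=> g0 [g0' [g1 [g1' [[E1 E2 E3 E4] [F1 F2 F3]]]]].
case=> l0 [l0' [l1 [l1' [[H1 H2 H3 H4] [L1 L2 L3]]]]].
have mulKK a b c (g : 'M[K]_(b, a)) (g' : 'M_(a, b)) (l : 'M_(c, b))
    (l' : 'M_(b, c)) : g *m g' = 1%:M -> l *m l' = 1%:M ->
    (l *m g) *m (g' *m l') = 1%:M.
  by move=> gg' ll'; rewrite mulmxA -(mulmxA l) gg' mulmx1.
exists (l0 *m g0), (g0' *m l0'), (l1 *m g1), (g1' *m l1').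
split; split; rewrite ?mulKK //.
- by rewrite mulmxA L1 -!mulmxA F1.
- by rewrite mulmxA L2 -!mulmxA F2.
- by rewrite mulmxA L3 -!mulmxA F3.
Qed.

Lemma iso_in_variety m d0 d1 e0 e1 (X : triple K d0 d1) (Y : triple K e0 e1) :
  iso X Y -> in_variety m X -> in_variety m Y.
Proof.
case=> g0 [g0' [g1 [g1' [[E1 E2 E3 E4] [F1 F2 F3]]]]] /in_varietyP[X0 X1 Xh].
have right_cancel a b c (g : 'M[K]_(b, a)) (g' : 'M_(a, b)) (A C : 'M_(c, b)) :
    g *m g' = 1%:M -> A *m g = C *m g -> A = C.
  by move=> gg' eAC; rewrite -[A]mulmx1 -[C]mulmx1 -gg' !mulmxA eAC.
apply/in_varietyP; split.
- apply: (right_cancel _ _ _ _ _ _ _ E1).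
  by rewrite (intertwine_exp _ F1) X0 mulmx0 mul0mx.
- apply: (right_cancel _ _ _ _ _ _ _ E3).
  by rewrite (intertwine_exp _ F2) X1 mulmx0 mul0mx.
apply: (right_cancel _ _ _ _ _ _ _ E3).
by rewrite -!mulmxA F3 F2 !mulmxA F1 F3 -!mulmxA Xh.
Qed.

Lemma iso_act d0 d1 (g0 : 'M[K]_d0) (g1 : 'M[K]_d1) (X : triple K d0 d1) :
  g0 \in unitmx -> g1 \in unitmx -> iso X (act g0 g1 X).
Proof.
case: X => [[M0 M1] h] u0 u1; exists g0, (invmx g0), g1, (invmx g1).
by split; split; rewrite ?mulmxV ?mulVmx ?mulmxKV.
Qed.

Lemma iso_ex_act d0 d1 (X Y : triple K d0 d1) : iso X Y ->
  exists g0 g1, [/\ g0 \in unitmx, g1 \in unitmx & Y = act g0 g1 X].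
Proof.
case=> g0 [g0' [g1 [g1' [[E1 E2 E3 E4] [F1 F2 F3]]]]].
have [u0 _] := mulmx1_unit E1; have [u1 _] := mulmx1_unit E3.
exists g0, g1; split=> //.
case: X Y F1 F2 F3 => [[M0 M1] h] [[N0 N1] k] /= <- <- <-.
by rewrite !mulmxK.
Qed.

Definition entry_fun d0 d1 (f : triple K d0 d1 -> K) :=
  [\/ exists i j, f = fun X => X.1.1 i j, exists i j, f = fun X => X.1.2 i j
    | exists i j, f = fun X => X.2 i j].

(** The degeneration relation. The closure is taken in the affine space of all triples, and the
    sizes of [G] and [X] may agree only propositionally. *)
Definition deg d0 d1 e0 e1 (G : triple K e0 e1) (X : triple K d0 d1) :=
  zclosure (@entry_fun d0 d1) (fun Y => iso G Y) X.

Lemma polyfun_mx_X0 d0 d1 :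
  polyfun_mx (@entry_fun d0 d1) (fun X => X.1.1).
Proof. by move=> i j; apply: polyfun_base; constructor 1; exists i, j. Qed.

Lemma polyfun_mx_X1 d0 d1 :
  polyfun_mx (@entry_fun d0 d1) (fun X => X.1.2).
Proof. by move=> i j; apply: polyfun_base; constructor 2; exists i, j. Qed.

Lemma polyfun_mx_Xh d0 d1 :
  polyfun_mx (@entry_fun d0 d1) (fun X => X.2).
Proof. by move=> i j; apply: polyfun_base; constructor 3; exists i, j. Qed.

Lemma zclosure_triple_map (T : Type) (B : (T -> K) -> Prop) d0 d1
    (phi : T -> triple K d0 d1) (S : triple K d0 d1 -> Prop) (S' : T -> Prop) x :
  polyfun_mx B (fun x => (phi x).1.1) -> polyfun_mx B (fun x => (phi x).1.2) ->
  polyfun_mx B (fun x => (phi x).2) ->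
  (forall y, S' y -> zclosure (@entry_fun d0 d1) S (phi y)) ->
  zclosure B S' x -> zclosure (@entry_fun d0 d1) S (phi x).
Proof.
move=> p0 p1 ph; apply: zclosure_map => g.
by case=> -[i [j ->]]; [apply: p0|apply: p1|apply: ph].
Qed.

Lemma deg_map d0 d1 e0 e1 c0 c1 b0 b1 (G : triple K e0 e1)
    (H : triple K b0 b1) (phi : triple K c0 c1 -> triple K d0 d1) X :
  polyfun_mx (@entry_fun c0 c1) (fun X => (phi X).1.1) ->
  polyfun_mx (@entry_fun c0 c1) (fun X => (phi X).1.2) ->
  polyfun_mx (@entry_fun c0 c1) (fun X => (phi X).2) ->
  (forall Y, iso H Y -> deg G (phi Y)) -> deg H X -> deg G (phi X).
Proof. exact: zclosure_triple_map. Qed.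

Lemma deg_line d0 d1 e0 e1 (G : triple K e0 e1) (M0 N0 : 'M[K]_d0)
    (M1 : 'M[K]_d1) (h k : 'M[K]_(d0, d1)) :
  (forall t, t != 0 -> deg G (M0 + t *: N0, M1, h + t *: k)) ->
  deg G (M0, M1, h).
Proof.
move=> Gt; have := @zclosure_triple_map _ (@is_id K) _ _
  (fun t => (M0 + t *: N0, M1, h + t *: k)) (iso G) _ 0 _ _ _ Gt.
rewrite !scale0r !addr0; apply; last exact: zclosure_line.
- apply: polyfun_mx_add; first exact: polyfun_mx_cst.
  by apply: polyfun_mx_scale (polyfun_mx_cst _ _); apply: polyfun_base.
- exact: polyfun_mx_cst.
- apply: polyfun_mx_add; first exact: polyfun_mx_cst.
  by apply: polyfun_mx_scale (polyfun_mx_cst _ _); apply: polyfun_base.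
Qed.

Lemma iso_deg d0 d1 e0 e1 (G : triple K e0 e1) (X : triple K d0 d1) :
  iso G X -> deg G X.
Proof. exact: zclosure_id. Qed.

Lemma deg_iso d0 d1 e0 e1 c0 c1 (G : triple K e0 e1) (X : triple K d0 d1)
    (Y : triple K c0 c1) : iso X Y -> deg G X -> deg G Y.
Proof.
case=> g0 [g0' [g1 [g1' [E [F1 F2 F3]]]]] GX.
pose phi (Z : triple K d0 d1) : triple K c0 c1 :=
  (g0 *m Z.1.1 *m g0', g1 *m Z.1.2 *m g1', g0 *m Z.2 *m g1').
have isophi Z : iso Z (phi Z).
  exists g0, g0', g1, g1'; split=> //; case: E => E1 E2 E3 E4.
  by split; rewrite /phi /= -mulmxA ?E2 ?E4 mulmx1.
have -> : Y = phi X.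
  case: E => E1 E2 E3 E4; case: Y F1 F2 F3 => [[N0 N1] k] /= F1 F2 F3.
  by rewrite /phi -F1 -F2 -F3 -!mulmxA E1 E3 !mulmx1.
apply: deg_map GX => [||| Z GZ]; last first.
  by apply: iso_deg; apply: iso_trans GZ (isophi Z).
all: apply: polyfun_mx_mul (polyfun_mx_cst _ _).
all: apply: polyfun_mx_mul (polyfun_mx_cst _ _) _.
- exact: polyfun_mx_Xh.
- exact: polyfun_mx_X1.
- exact: polyfun_mx_X0.
Qed.

Lemma deg_trans d0 d1 e0 e1 c0 c1 (G : triple K e0 e1) (H : triple K c0 c1)
    (X : triple K d0 d1) :
  (forall Y : triple K d0 d1, iso H Y -> deg G Y) -> deg H X -> deg G X.
Proof. by move=> GH HX p pp Gp; apply: HX => // Y /GH; apply. Qed.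

(** Vector space duality; it exchanges the two modules and so allows the reduction to [d1 <= d0]. *)
Definition dualize d0 d1 (X : triple K d0 d1) : triple K d1 d0 :=
  (X.1.2^T, X.1.1^T, X.2^T).

Lemma dualizeK d0 d1 : cancel (@dualize d0 d1) (@dualize d1 d0).
Proof. by case=> [[M0 M1] h]; rewrite /dualize /= !trmxK. Qed.

Lemma dualize_in_variety m d0 d1 (X : triple K d0 d1) :
  in_variety m X -> in_variety m (dualize X).
Proof.
move/in_varietyP=> [X0 X1 Xh]; apply/in_varietyP.
by rewrite /dualize /= -!trmx_exp X0 X1 !trmx0 -!trmx_mul Xh.
Qed.

Lemma iso_dualize d0 d1 e0 e1 (X : triple K d0 d1) (Y : triple K e0 e1) :
  iso X Y -> iso (dualize X) (dualize Y).
Proof.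
move/iso_sym=> [g0 [g0' [g1 [g1' [[E1 E2 E3 E4] [F1 F2 F3]]]]]].
exists g1^T, g1'^T, g0^T, g0'^T.
split; split; rewrite /dualize /= -?trmx_mul ?E1 ?E2 ?E3 ?E4 ?trmx1 //.
- by rewrite F2.
- by rewrite F1.
- by rewrite F3.
Qed.

Lemma deg_dualize d0 d1 e0 e1 (G : triple K e0 e1) (X : triple K d0 d1) :
  deg G X -> deg (dualize G) (dualize X).
Proof.
apply: deg_map => [||| Y /iso_dualize GY]; last exact: iso_deg.
- exact/polyfun_mx_tr/polyfun_mx_X1.
- exact/polyfun_mx_tr/polyfun_mx_X0.
- exact/polyfun_mx_tr/polyfun_mx_Xh.
Qed.

End Triples.

(** * Nilpotent matrices *)

Section NilpotentMatrices.
Variable K : closedFieldType.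
Implicit Types (n m d e a b c : nat).

(** For [A = M ^+ n] with [M ^+ n.+1 = 0], such a form and vector are the data that split off a
    summand K[x]/(x^(n+1)). *)
Lemma mx_neq0_probe a b (A : 'M[K]_(a, b)) : A != 0 ->
  exists (e : 'rV_a) (v : 'cV_b), e *m A *m v != 0.
Proof.
move=> A0; apply: contrapT => nA; case/eqP: A0; apply/matrixP => i j.
rewrite mxE; apply/eqP; apply: contrapT => /negP Aij; apply: nA.
exists (delta_mx 0 i), (delta_mx j 0); rewrite -rowE -colE.
by apply: contraNneq Aij => /matrixP/(_ 0 0); rewrite !mxE => ->.
Qed.

Lemma matrix_eq_col a b (A B : 'M[K]_(a, b)) :
  (forall j, col j A = col j B) -> A = B.
Proof. by move=> AB; apply/matrixP => i j; move/colP/(_ i): (AB j); rewrite !mxE. Qed.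

Lemma outer_mx_neq0 a b (v : 'cV[K]_a) (e : 'rV[K]_b) :
  v != 0 -> e != 0 -> v *m e != 0.
Proof.
move=> v0 e0; apply: contraNneq v0 => ve0.
have [j ej] : exists j, e 0 j != 0.
  apply: contrapT => ne; case/eqP: e0; apply/rowP => j; rewrite mxE.
  by apply/eqP; apply: contrapT => /negP ej; apply: ne; exists j.
apply/eqP/colP => i; move/matrixP/(_ i j)/eqP: ve0.
by rewrite !mxE big_ord1 mulf_eq0 (negPf ej) orbF => /eqP.
Qed.

(** Multiplication by x on K[x]/(x^m) in the basis of the powers of x. *)
Definition shift_mx m : 'M[K]_m := \matrix_(i, j) (i == j.+1 :> nat)%:R.

Lemma shift_mx_exp m k i j : (shift_mx m ^+ k) i j = (i == j + k :> nat)%N%:R.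
Proof.
elim: k i j => [|k IHk] i j.
  by rewrite expr0 addn0 mxE.
rewrite exprSr_mx mxE.
case: (ltnP j.+1 m) => jm; last first.
  rewrite big1 => [|l _].
    by rewrite (_ : (_ == _) = false) //; have := ltn_ord i; lia.
  by rewrite mxE (_ : (l == j.+1 :> nat) = false) ?mulr0 //; have := ltn_ord l; lia.
rewrite (bigD1 (Ordinal jm)) //= big1 => [|l /negPf lj]; last first.
  rewrite mxE (_ : (l == j.+1 :> nat) = false) ?mulr0 //.
by rewrite IHk mxE /= eqxx mulr1 addr0 addSnnS.
Qed.

Lemma shift_mx_nilp m : shift_mx m ^+ m = 0.
Proof.
apply/matrixP => i j; rewrite shift_mx_exp mxE.
by rewrite (_ : (_ == _) = false) //; have := ltn_ord i; lia.
Qed.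

Lemma shift_mx_exp_neq0 n : shift_mx n.+1 ^+ n != 0.
Proof.
apply/eqP => /matrixP/(_ ord_max ord0)/eqP.
by rewrite shift_mx_exp !mxE /= eqxx oner_eq0.
Qed.

(** When [M ^+ k = 0], this is the homomorphism to K[x]/(x^k) whose coefficient of x^(k-1), the last
    row, is the linear form [e]. *)
Definition krylov_rows k d (e : 'rV[K]_d) (M : 'M[K]_d) : 'M_(k, d) :=
  \matrix_(i < k) (e *m M ^+ (k.-1 - i)).

(** When [M ^+ k = 0], this is the homomorphism from K[x]/(x^k) that sends 1 to [v]. *)
Definition krylov_cols k d (v : 'cV[K]_d) (M : 'M[K]_d) : 'M_(d, k) :=
  \matrix_(i < d, j < k) (M ^+ j *m v) i 0.

Lemma col_krylov_cols k d (v : 'cV[K]_d) M (j : 'I_k) :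
  col j (krylov_cols k v M) = M ^+ j *m v.
Proof. by apply/colP => i; rewrite !mxE. Qed.

Lemma krylov_rows_shift k d (e : 'rV[K]_d) (M : 'M[K]_d) : M ^+ k = 0 ->
  shift_mx k *m krylov_rows k e M = krylov_rows k e M *m M.
Proof.
move=> Mk0; apply/row_matrixP => i; rewrite !row_mul rowK mulmx_sum_row.
case: i => [[|i] ik] /=.
  rewrite big1 => [|l _]; last by rewrite !mxE /= scale0r.
  by rewrite subn0 -mulmxA -exprSr_mx prednK // Mk0 mulmx0.
rewrite (bigD1 (Ordinal (ltnW ik))) //= big1 => [|l /negPf li]; last first.
  by rewrite !mxE eqSS eq_sym (_ : (_ == _) = false) ?scale0r // -li.
rewrite !mxE eqxx scale1r addr0 rowK -mulmxA -exprSr_mx /=.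
by rewrite (_ : (k.-1 - i = (k.-1 - i.+1).+1)%N) //; lia.
Qed.

Lemma krylov_rows_mul k d0 d1 (e : 'rV[K]_d0) (M0 : 'M[K]_d0) (M1 : 'M[K]_d1)
    (h : 'M[K]_(d0, d1)) : M0 *m h = h *m M1 ->
  krylov_rows k e M0 *m h = krylov_rows k (e *m h) M1.
Proof.
move=> hE; apply/row_matrixP => i; rewrite row_mul !rowK -!mulmxA.
by rewrite (intertwine_exp _ hE).
Qed.

Lemma krylov_cols_mul k d0 d1 (v : 'cV[K]_d1) (M0 : 'M[K]_d0) (M1 : 'M[K]_d1)
    (h : 'M[K]_(d0, d1)) : M0 *m h = h *m M1 ->
  h *m krylov_cols k v M1 = krylov_cols k (h *m v) M0.
Proof.
move=> hE; apply: matrix_eq_col => i.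
rewrite col_krylov_cols colE -mulmxA -colE col_krylov_cols.
by rewrite !mulmxA (intertwine_exp _ hE).
Qed.

(** The entry at (i, j) is the value of [e *m M ^+ (n - i + j) *m v], which is zero for i < j. The
    matrix is thus triangular, with the nonzero value of [e *m M ^+ n *m v] along the diagonal. *)
Lemma krylov_pairing_unit n d (e : 'rV[K]_d) (v : 'cV[K]_d) (M : 'M[K]_d) :
  M ^+ n.+1 = 0 -> e *m M ^+ n *m v != 0 ->
  krylov_rows n.+1 e M *m krylov_cols n.+1 v M \in unitmx.
Proof.
move=> Mn0 eMv.
have RC i j : (krylov_rows n.+1 e M *m krylov_cols n.+1 v M) i j =
    (e *m M ^+ (n - i + j) *m v) 0 0.
  have -> : (krylov_rows n.+1 e M *m krylov_cols n.+1 v M) i j =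
    (row i (krylov_rows n.+1 e M) *m col j (krylov_cols n.+1 v M)) 0 0.
    by rewrite !mxE; apply: eq_bigr => l _; rewrite !mxE.
  by rewrite rowK col_krylov_cols exprD_mx !mulmxA.
rewrite unitmxE det_trig; last first.
  apply/is_trig_mxP => i j ij; rewrite RC.
  rewrite (@expr_mx_eq0 _ _ M n.+1) ?mulmx0 ?mul0mx ?mxE //.
  by have := ltn_ord j; lia.
rewrite unitfE; apply/prodf_neq0 => i _.
have i_le_n : (i <= n)%N by rewrite -ltnS.
rewrite RC (subnK i_le_n); apply: contraNneq eMv => eMv0.
by apply/eqP/matrixP => k l; rewrite !ord1 eMv0 mxE.
Qed.

(* [P = <v>] is a direct summand: [krylov_rows] is a retraction onto it, and [Q]
   is a basis of the linear forms vanishing on it. *)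
Lemma nilp_split n d (e : 'rV[K]_d) (v : 'cV[K]_d) (M : 'M[K]_d) :
  M ^+ n.+1 = 0 -> e *m M ^+ n *m v != 0 ->
  exists d' (Q : 'M[K]_(d', d)) (M' : 'M[K]_d') (g' : 'M[K]_(d, n.+1 + d')),
  [/\ (n.+1 + d' = d)%N, Q *m M = M' *m Q,
      forall k (Z : 'M[K]_(k, d)), Z *m krylov_cols n.+1 v M = 0 ->
        exists Z' : 'M_(k, d'), Z = Z' *m Q,
      Q *m krylov_cols n.+1 v M = 0 &
      col_mx (krylov_rows n.+1 e M) Q *m g' = 1%:M
      /\ g' *m col_mx (krylov_rows n.+1 e M) Q = 1%:M].
Proof.
move=> Mn0 eMv; have RCu := krylov_pairing_unit Mn0 eMv.
set R := krylov_rows _ _ _ in RCu *; set C := krylov_cols _ _ _ in RCu *.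
have [Q [subQ QC Qfree]] : exists Q : 'M_(\rank (kermx C), d),
    [/\ forall k (Z : 'M[K]_(k, d)), Z *m C = 0 -> exists Z', Z = Z' *m Q,
        Q *m C = 0 & row_free Q].
  exists (row_base (kermx C)); split; last exact: row_base_free.
    by move=> k Z ZC; apply/submxP; rewrite eq_row_base; apply/sub_kermxP.
  by apply/sub_kermxP; rewrite eq_row_base.
(* The span of the columns of [C] is stable under [M] because [M ^+ n.+1 = 0]; [M'] is the action on
   the quotient by it. *)
have [M' QM] : exists M', Q *m M = M' *m Q.
  apply: subQ; rewrite -mulmxA; apply: matrix_eq_col => i.
  rewrite col0 colE -!mulmxA -colE col_krylov_cols.
  rewrite [M *m _]mulmxA -exprS_mx; case: (ltnP i.+1 n.+1) => iN.
    by rewrite -(col_krylov_cols v M (Ordinal iN)) colE -/C mulmxA QC mul0mx.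
  by rewrite (@expr_mx_eq0 _ _ M n.+1) // mul0mx mulmx0.
have rC : \rank C = n.+1.
  apply/eqP; rewrite eqn_leq rank_leq_col -{1}(mxrank_unit RCu).
  exact: mxrankM_maxr.
have dE : (n.+1 + \rank (kermx C) = d)%N.
  by rewrite mxrank_ker rC subnKC // -rC rank_leq_row.
have RQfree : row_free (col_mx R Q).
  rewrite -kermx_eq0; apply/rowV0P => w /sub_kermxP.
  rewrite -[w]hsubmxK mul_row_col => E.
  have a0 : lsubmx w = 0.
    have := congr1 (mulmx^~ C) E; rewrite mulmxDl -!mulmxA QC mulmx0 addr0 mul0mx.
    by move/(congr1 (mulmx^~ (invmx (R *m C)))); rewrite mulmxK // mul0mx.
  move: E; rewrite a0 mul0mx add0r => E.
  suff -> : rsubmx w = 0 by rewrite row_mx0.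
  by apply: (row_free_inj Qfree); rewrite E mul0mx.
have [g' RQg] := row_freeP RQfree.
exists (\rank (kermx C)), Q, M', g'; split=> //; split=> //.
(* The stacked matrix becomes square only once [dE] is substituted; its right inverse is then also a
   left inverse. *)
clear subQ QC QM; move: (col_mx R Q) g' RQg {RQfree}.
move: (n.+1 + _)%N dE => d' dE; subst d' => g g' gg'.
exact: mulmx1C.
Qed.

Lemma nilp_order_le n d (M : 'M[K]_d) : M ^+ n.+1 = 0 -> M ^+ n != 0 -> (n < d)%N.
Proof.
move=> Mn0 /mx_neq0_probe[e [v eMv]].
have [d' [_ [_ [_ [dE _ _ _ _]]]]] := nilp_split Mn0 eMv.
by rewrite -dE leq_addr.
Qed.

(** Lower the exponent as long as the power stays zero; at the last nonzero power, [nilp_order_le]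
    bounds the exponent by the dimension. *)
Lemma nilp_exp_dim m d (M : 'M[K]_d) : M ^+ m = 0 -> M ^+ d = 0.
Proof.
elim: m => [|m IHm] Mm0; first exact: expr_mx_eq0 Mm0.
have [/IHm //|M_neq0] := eqVneq (M ^+ m) 0.
exact: expr_mx_eq0 (nilp_order_le Mm0 M_neq0) Mm0.
Qed.

Lemma nilp_index m d (M : 'M[K]_d) : M ^+ m = 0 -> (0 < d)%N ->
  exists2 q, M ^+ q.+1 = 0 & M ^+ q != 0.
Proof.
case: d M => // d M Mm _; elim: m Mm => [|m IHm] Mm.
  by move/eqP: Mm; rewrite expr0 oner_eq0.
by have [/IHm //|M_neq0] := eqVneq (M ^+ m) 0; exists m.
Qed.

(** The upper right block of the [k]-th power of [[A B; 0 E]], isolated because it is linear in [B]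
    and can be followed along a line of extensions. *)
Fixpoint ext_pow a b (A : 'M[K]_a) (E : 'M[K]_b) k (B : 'M[K]_(a, b)) :=
  if k is k'.+1 then A *m ext_pow A E k' B + B *m E ^+ k' else 0.

Section ExtensionPowers.
Variables (a b : nat) (A : 'M[K]_a) (E : 'M[K]_b).

Lemma block_mx_exp B k :
  (block_mx A B 0 E) ^+ k = block_mx (A ^+ k) (ext_pow A E k B) 0 (E ^+ k).
Proof.
elim: k => [|k IHk]; first by rewrite !expr0 /= -scalar_mx_block.
rewrite exprS_mx IHk mulmx_block !mulmx0 !mul0mx !addr0 !add0r.
by rewrite -!exprS_mx.
Qed.

Lemma ext_powD k B B' :
  ext_pow A E k (B + B') = ext_pow A E k B + ext_pow A E k B'.
Proof.
elim: k => [|k IHk] /=; first by rewrite addr0.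
by rewrite IHk mulmxDr mulmxDl addrACA.
Qed.

Lemma ext_powZ k t B : ext_pow A E k (t *: B) = t *: ext_pow A E k B.
Proof.
elim: k => [|k IHk] /=; first by rewrite scaler0.
by rewrite IHk -scalemxAr -scalemxAl scalerDr.
Qed.

Lemma ext_pow_mulA k B : ext_pow A E k (A *m B) = A *m ext_pow A E k B.
Proof.
elim: k => [|k IHk] /=; first by rewrite mulmx0.
by rewrite IHk mulmxDr !mulmxA.
Qed.

Lemma ext_pow0 k : ext_pow A E k 0 = 0.
Proof. by elim: k => //= k ->; rewrite mulmx0 mul0mx addr0. Qed.

Lemma ext_powE k B :
  ext_pow A E k B = \sum_(i < k) A ^+ i *m B *m E ^+ (k.-1 - i).
Proof.
elim: k => [|k IHk] /=; first by rewrite big_ord0.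
rewrite big_ord_recl expr0 mul1mx subn0 addrC IHk mulmx_sumr; congr (_ + _).
apply: eq_bigr => i _; rewrite !mulmxA -exprS_mx.
by rewrite lift0 subnS predn_sub.
Qed.

(* [ext_pow n.+1 = A * ext_pow n] once [E ^+ n = 0], so it suffices that
   [ext_pow n] is nonzero: multiply a value of it by a maximal power of [A]. *)
Lemma ext_pow_step n p q : A ^+ p.+1 = 0 -> A ^+ p != 0 ->
    E ^+ q.+1 = 0 -> E ^+ q != 0 -> E ^+ n = 0 ->
    (q < n)%N -> (n <= p + q.+1)%N ->
  exists2 B, ext_pow A E n B != 0 & ext_pow A E n.+1 B = 0.
Proof.
move=> Ap0 Ap Eq0 Eq En0 qn npq.
have [e0 [f eAf]] := mx_neq0_probe Ap; have [eps [u eEu]] := mx_neq0_probe Eq.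
pose B0 := f *m eps.
have DB0 : ext_pow A E n B0 != 0.
  suff : A ^+ (p + q.+1 - n) *m ext_pow A E n B0 = (A ^+ p *m f) *m (eps *m E ^+ q).
    have : (A ^+ p *m f) *m (eps *m E ^+ q) != 0.
      apply: outer_mx_neq0.
        by apply: contraNneq eAf; rewrite -mulmxA => ->; rewrite mulmx0.
      by apply: contraNneq eEu => ->; rewrite mul0mx.
    by move=> nz E0; apply: contraNneq nz => D0; rewrite -E0 D0 mulmx0.
  (* Only the summand [i = n - q.+1] survives the multiplication: a smaller [i] leaves a power of
     [E] beyond [q], a larger one a power of [A] beyond [p]. *)
  have i0P : (n - q.+1 < n)%N by lia.
  rewrite ext_powE mulmx_sumr (bigD1 (Ordinal i0P)) //= big1 => [|i ni0].
    rewrite addr0 !mulmxA -exprD_mx.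
    rewrite (_ : (p + q.+1 - n + (n - q.+1) = p)%N); last by lia.
    by rewrite (_ : (n.-1 - (n - q.+1) = q)%N) //; lia.
  have ni : (i != n - q.+1 :> nat)%N by [].
  have in' := ltn_ord i.
  rewrite !mulmxA -exprD_mx; have [iq|iq] := leqP i (n - q.+1).
    by rewrite (@expr_mx_eq0 _ _ E q.+1) ?mulmx0 //; lia.
  by rewrite (@expr_mx_eq0 _ _ A p.+1) ?mul0mx //; lia.
have [c [Dc Dc1]] : exists c, ext_pow A E n (A ^+ c *m B0) != 0
    /\ ext_pow A E n (A ^+ c.+1 *m B0) = 0.
  have Dp : ext_pow A E n (A ^+ p.+1 *m B0) = 0 by rewrite Ap0 mul0mx ext_pow0.
  elim: p.+1 Dp => [|k IHk] Dk; first by case/eqP: DB0; move: Dk; rewrite expr0 mul1mx.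
  have [/IHk //|Dk0] := eqVneq (ext_pow A E n (A ^+ k *m B0)) 0.
  by exists k.
exists (A ^+ c *m B0) => //=.
by rewrite En0 mulmx0 addr0 -ext_pow_mulA mulmxA -exprS_mx.
Qed.

End ExtensionPowers.

Lemma diag_block_exp a b (A : 'M[K]_a) (E : 'M[K]_b) k :
  (block_mx A 0 0 E) ^+ k = block_mx (A ^+ k) 0 0 (E ^+ k).
Proof. by rewrite block_mx_exp ext_pow0. Qed.

Lemma block_mx_neq0_ul a1 a2 b1 b2 (A : 'M[K]_(a1, b1)) (B : 'M[K]_(a1, b2))
    (C : 'M[K]_(a2, b1)) (D : 'M[K]_(a2, b2)) : A != 0 -> block_mx A B C D != 0.
Proof.
by apply: contraNneq; rewrite -block_mx0 => /eq_block_mx[-> _ _ _].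
Qed.

Lemma block_mx_neq0_ur a1 a2 b1 b2 (A : 'M[K]_(a1, b1)) (B : 'M[K]_(a1, b2))
    (C : 'M[K]_(a2, b1)) (D : 'M[K]_(a2, b2)) : B != 0 -> block_mx A B C D != 0.
Proof.
by apply: contraNneq; rewrite -block_mx0 => /eq_block_mx[_ -> _ _].
Qed.

Lemma ex_nilp_index k d : (k < d)%N ->
  exists A : 'M[K]_d, A ^+ k.+1 = 0 /\ A ^+ k != 0.
Proof.
move=> /subnKC <-; exists (block_mx (shift_mx k.+1) 0 0 0).
rewrite !diag_block_exp shift_mx_nilp exprS_mx mul0mx; split.
  by rewrite /block_mx !row_mx0 col_mx0.
exact/block_mx_neq0_ul/shift_mx_exp_neq0.
Qed.

End NilpotentMatrices.

(** * Splitting off K[x]/(x^m) *)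

Section Summands.
Variable K : closedFieldType.
Implicit Types (n m d e a b c : nat).

(* Extends [X] by [P = K[x]/(x^n.+1)] in degree 0: the homomorphisms from the
   degree-1 part to the injective module [P] correspond to the linear forms. *)
Definition addP n d0 d1 (xi : 'rV[K]_d1) (X : triple K d0 d1) :
    triple K (n.+1 + d0) d1 :=
  (block_mx (shift_mx K n.+1) 0 0 X.1.1, X.1.2,
   col_mx (krylov_rows n.+1 xi X.1.2) X.2).

Definition addPP n d0 d1 (X : triple K d0 d1) :
    triple K (n.+1 + d0) (n.+1 + d1) :=
  (block_mx (shift_mx K n.+1) 0 0 X.1.1, block_mx (shift_mx K n.+1) 0 0 X.1.2,
   block_mx 1%:M 0 0 X.2).

Lemma addP_in_variety n d0 d1 (xi : 'rV[K]_d1) (X : triple K d0 d1) :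
  in_variety n.+1 X -> in_variety n.+1 (addP n xi X).
Proof.
move=> /in_varietyP[X0 X1 Xh]; apply/in_varietyP; split=> //=.
  by rewrite diag_block_exp shift_mx_nilp X0 /block_mx !row_mx0 col_mx0.
by rewrite mul_block_col !mul0mx add0r addr0 krylov_rows_shift // Xh mul_col_mx.
Qed.

Lemma addPP_in_variety n d0 d1 (X : triple K d0 d1) :
  in_variety n.+1 X -> in_variety n.+1 (addPP n X).
Proof.
move=> /in_varietyP[X0 X1 Xh]; apply/in_varietyP; split=> /=.
- by rewrite diag_block_exp shift_mx_nilp X0 /block_mx !row_mx0 col_mx0.
- by rewrite diag_block_exp shift_mx_nilp X1 /block_mx !row_mx0 col_mx0.
by rewrite !mulmx_block !(mul0mx, mulmx0, addr0, add0r) mulmx1 mul1mx Xh.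
Qed.

Lemma diag1_mul a b c (g : 'M[K]_(b, c)) (g' : 'M[K]_(c, b)) :
  g *m g' = 1%:M ->
  block_mx (1%:M : 'M_a) 0 0 g *m block_mx 1%:M 0 0 g' = 1%:M.
Proof.
move=> gg'; rewrite mulmx_block !(mul0mx, mulmx0, addr0, add0r) mulmx1 gg'.
by rewrite -scalar_mx_block.
Qed.

(** The form is transported along the inverse of the isomorphism in degree 1. The last two clauses
    record the only features of the form that are tracked later. *)
Lemma iso_addP n d0 d1 e0 e1 (xi : 'rV[K]_d1) (X : triple K d0 d1)
    (Y : triple K e0 e1) : iso X Y ->
  exists xi', [/\ iso (addP n xi X) (addP n xi' Y),
    (forall k, xi *m X.1.2 ^+ k != 0 -> xi' *m Y.1.2 ^+ k != 0)
    & (xi = 0 -> xi' = 0)].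
Proof.
case=> g0 [g0' [g1 [g1' [[E1 E2 E3 E4] [F1 F2 F3]]]]].
have F2' : X.1.2 *m g1' = g1' *m Y.1.2 by apply: intertwine_inv F2.
exists (xi *m g1'); split; last by move=> ->; rewrite mul0mx.
  exists (block_mx 1%:M 0 0 g0), (block_mx 1%:M 0 0 g0'), g1, g1'.
  split; split; rewrite ?diag1_mul //=.
    by rewrite !mulmx_block !(mul0mx, mulmx0, addr0, add0r) mulmx1 mul1mx F1.
  rewrite mul_block_col !(mul0mx, mulmx0, addr0, add0r) mul1mx mul_col_mx F3.
  by rewrite (krylov_rows_mul _ _ F2) -mulmxA E4 mulmx1.
move=> k; rewrite -mulmxA -(intertwine_exp _ F2').
apply: contraNneq => /(congr1 (mulmx^~ g1)) /=.
by rewrite mul0mx -!mulmxA E4 mulmx1 => ->.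
Qed.

Lemma iso_addPP n d0 d1 e0 e1 (X : triple K d0 d1) (Y : triple K e0 e1) :
  iso X Y -> iso (addPP n X) (addPP n Y).
Proof.
case=> g0 [g0' [g1 [g1' [[E1 E2 E3 E4] [F1 F2 F3]]]]].
exists (block_mx 1%:M 0 0 g0), (block_mx 1%:M 0 0 g0').
exists (block_mx 1%:M 0 0 g1), (block_mx 1%:M 0 0 g1').
split; split; rewrite ?diag1_mul //= !mulmx_block !(mul0mx, mulmx0, addr0, add0r).
- by rewrite mulmx1 mul1mx F1.
- by rewrite mulmx1 mul1mx F2.
- by rewrite mulmx1 F3.
Qed.

(** The form [xi] stays fixed while [Y] runs through the orbit of [H]. The resulting triples may lie
    in different orbits, so the hypothesis has to treat every [Y]. *)
Lemma deg_addP n d0 d1 e0 e1 c0 c1 (G : triple K e0 e1) (H : triple K c0 c1)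
    (xi : 'rV[K]_d1) (X : triple K d0 d1) :
  (forall Y : triple K d0 d1, iso H Y -> deg G (addP n xi Y)) ->
  deg H X -> deg G (addP n xi X).
Proof.
apply: deg_map => /=; last 1 first.
- apply: polyfun_mx_col; last exact: polyfun_mx_Xh.
  move=> i j; apply: eq_polyfun (polyfun_mx_mul (polyfun_mx_cst _ xi)
    (polyfun_mx_exp (n.+1.-1 - i) (@polyfun_mx_X1 K d0 d1)) 0 j) => Y.
  by rewrite !mxE.
- by apply: polyfun_mx_block; (exact: polyfun_mx_cst || exact: polyfun_mx_X0).
- exact: polyfun_mx_X1.
Qed.

Lemma deg_addPP n d0 d1 e0 e1 (G : triple K e0 e1) (X : triple K d0 d1) :
  deg G X -> deg (addPP n G) (addPP n X).
Proof.
apply: deg_map => /= [|||Y /(iso_addPP n)]; last exact: iso_deg.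
- by apply: polyfun_mx_block; (exact: polyfun_mx_cst || exact: polyfun_mx_X0).
- by apply: polyfun_mx_block; (exact: polyfun_mx_cst || exact: polyfun_mx_X1).
- by apply: polyfun_mx_block; (exact: polyfun_mx_cst || exact: polyfun_mx_Xh).
Qed.

(** The form [e] gives a retraction of N0 onto the summand P generated by [v]. Its composite with h
    is the homomorphism given by the form [e *m X.2], and [X'] has the quotient of N0 by P in degree
    0. *)
Lemma addP_split n d0 d1 (X : triple K d0 d1) (e : 'rV[K]_d0) (v : 'cV[K]_d0) :
  in_variety n.+1 X -> e *m X.1.1 ^+ n *m v != 0 ->
  exists d0' (X' : triple K d0' d1),
    [/\ (n.+1 + d0' = d0)%N, in_variety n.+1 X' & iso X (addP n (e *m X.2) X')].
Proof.
case: X => [[M0 M1] h] XV /=; have /in_varietyP[/= M0n M1n hE] := XV => eMv.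
have [d0' [Q [M' [g' [dE QM _ _ [RQg gRQ]]]]]] := nilp_split M0n eMv.
pose X' : triple K d0' d1 := (M', M1, Q *m h).
have XX' : iso (M0, M1, h) (addP n (e *m h) X').
  exists (col_mx (krylov_rows n.+1 e M0) Q), g', 1%:M, 1%:M.
  split; split; rewrite ?mulmx1 ?mul1mx //=.
    rewrite mul_block_col !mul0mx addr0 add0r mul_col_mx QM.
    by rewrite krylov_rows_shift.
  by rewrite mul_col_mx (krylov_rows_mul _ _ hE).
exists d0', X'; split=> //; apply/in_varietyP.
have /in_varietyP[/= P0 P1 Ph] := iso_in_variety XX' XV.
split=> //=.
  by move: P0; rewrite diag_block_exp -block_mx0 => /eq_block_mx[_ _ _ ->].
move: Ph; rewrite mul_block_col !mul0mx addr0 add0r mul_col_mx.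
by case/eq_col_mx.
Qed.

(** Some [v] in N1 generates a copy of P that h maps isomorphically onto the one generated by
    [h *m v]. A retraction given by [e] on N0 pulls back to the one given by [e *m h] on N1, so the
    two copies split off compatibly. *)
Lemma addPP_split n d0 d1 (X : triple K d0 d1) :
  in_variety n.+1 X -> X.2 *m X.1.2 ^+ n != 0 ->
  exists d0' d1' (X' : triple K d0' d1'),
    [/\ (n.+1 + d0' = d0)%N, (n.+1 + d1' = d1)%N, in_variety n.+1 X'
      & iso X (addPP n X')].
Proof.
case: X => [[M0 M1] h] XV /=; have /in_varietyP[/= M0n M1n hE] := XV.
move=> /mx_neq0_probe[e [v ehMv]].
have hEn : M0 ^+ n *m h = h *m M1 ^+ n by apply: intertwine_exp.
have eMv0 : e *m M0 ^+ n *m (h *m v) != 0 by rewrite mulmxA -(mulmxA e) hEn.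
have eMv1 : (e *m h) *m M1 ^+ n *m v != 0 by rewrite -(mulmxA e).
have [d0' [Q0 [M0' [g0 [dE0 QM0 _ QC0 [RQ0 gRQ0]]]]]] := nilp_split M0n eMv0.
have [d1' [Q1 [M1' [g1 [dE1 QM1 subQ1 _ [RQ1 gRQ1]]]]]] := nilp_split M1n eMv1.
(* As h sends the summand generated by [v] into the one generated by [h *m v], it induces a map [h']
   between the quotients. *)
have [h' hE'] : exists h', Q0 *m h = h' *m Q1.
  by apply: subQ1; rewrite -mulmxA (krylov_cols_mul _ _ hE).
have XX' : iso (M0, M1, h) (addPP n (M0', M1', h')).
  exists (col_mx (krylov_rows n.+1 e M0) Q0), g0.
  exists (col_mx (krylov_rows n.+1 (e *m h) M1) Q1), g1.
  split; split; rewrite //= mul_block_col !mul0mx addr0 add0r mul_col_mx.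
  - by rewrite QM0 krylov_rows_shift.
  - by rewrite QM1 krylov_rows_shift.
  - by rewrite mul1mx -hE' (krylov_rows_mul _ _ hE).
exists d0', d1', (M0', M1', h'); split=> //; apply/in_varietyP.
have /in_varietyP[/= P0 P1 Ph] := iso_in_variety XX' XV.
split=> /=.
- by move: P0; rewrite diag_block_exp -block_mx0 => /eq_block_mx[_ _ _ ->].
- by move: P1; rewrite diag_block_exp -block_mx0 => /eq_block_mx[_ _ _ ->].
move: Ph; rewrite !mulmx_block !(mul0mx, mulmx0, addr0, add0r).
by case/eq_block_mx.
Qed.

End Summands.

(** * Degenerations along lines of homomorphisms and of extensions *)

Section Degenerations.
Variable K : closedFieldType.
Implicit Types (n m d e a b c : nat).

Definition has_generic m d0 d1 := exists G : triple K d0 d1,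
  in_variety m G /\ forall X : triple K d0 d1, in_variety m X -> deg G X.

Lemma iso_exp0_neq0 d0 d1 e0 e1 (X : triple K d0 d1) (Y : triple K e0 e1) k :
  iso X Y -> X.1.1 ^+ k != 0 -> Y.1.1 ^+ k != 0.
Proof.
case=> g0 [g0' [_ [_ [[_ E _ _] [F _ _]]]]]; apply: contraNneq => Y0.
by rewrite -[X.1.1 ^+ k]mul1mx -E -mulmxA -(intertwine_exp _ F) Y0 mul0mx mulmx0.
Qed.

Lemma iso_exp1_neq0 d0 d1 e0 e1 (X : triple K d0 d1) (Y : triple K e0 e1) k :
  iso X Y -> X.1.2 ^+ k != 0 -> Y.1.2 ^+ k != 0.
Proof.
case=> _ [_ [g1 [g1' [[_ _ _ E] [_ F _]]]]]; apply: contraNneq => Y0.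
by rewrite -[X.1.2 ^+ k]mul1mx -E -mulmxA -(intertwine_exp _ F) Y0 mul0mx mulmx0.
Qed.

(** Allows the orbit of a generic [H] to be replaced by one representative [Y] in a convenient
    normal form. *)
Lemma deg_through d0 d1 e0 e1 c0 c1 b0 b1 (G : triple K e0 e1)
    (H : triple K c0 c1) (Y : triple K b0 b1) (X : triple K d0 d1) :
  iso H Y -> deg G Y -> deg H X -> deg G X.
Proof.
move=> HY GY; apply: deg_trans => Z HZ.
exact: deg_iso (iso_trans (iso_sym HY) HZ) GY.
Qed.

Lemma has_generic_dualize m d0 d1 : has_generic m d0 d1 -> has_generic m d1 d0.
Proof.
case=> G [Gv GX]; exists (dualize G); split; first exact: dualize_in_variety.
by move=> X /dualize_in_variety/GX/deg_dualize; rewrite dualizeK.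
Qed.

(** Writing D for [ext_pow A E k B], telescoping gives A D - D E = A^k B - B E^k. So D is a
    homomorphism of modules once both powers vanish. *)
Lemma ext_pow_comm a b (A : 'M[K]_a) (E : 'M[K]_b) k B :
  A ^+ k = 0 -> E ^+ k = 0 -> A *m ext_pow A E k B = ext_pow A E k B *m E.
Proof.
move=> Ak Ek; suff : A *m ext_pow A E k B + B *m E ^+ k
    = A ^+ k *m B + ext_pow A E k B *m E.
  by rewrite Ak Ek mulmx0 mul0mx addr0 add0r.
elim: k {Ak Ek} => [|k IHk] /=.
  by rewrite !expr0 mulmx0 mul0mx mul1mx mulmx1 addr0 add0r.
by rewrite {1}IHk mulmxDr mulmxDl (exprSr_mx E) (exprS_mx A) !mulmxA addrA.
Qed.

(** Every summand other than A^k B contains a positive power of [E], which the factor [E ^+ n]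
    brings to zero. *)
Lemma ext_pow_mul_exp a b (A : 'M[K]_a) (E : 'M[K]_b) n k B :
  E ^+ n.+1 = 0 -> ext_pow A E k.+1 B *m E ^+ n = A ^+ k *m B *m E ^+ n.
Proof.
move=> En; elim: k => [|k IHk].
  by rewrite /= mulmx0 !expr0 mulmx1 mul1mx add0r.
rewrite [ext_pow _ _ _ _]/= -/(ext_pow A E k.+1 B) mulmxDl -!mulmxA -exprD_mx.
rewrite (@expr_mx_eq0 _ _ E n.+1 (k.+1 + n)) ?mulmx0 ?addr0 ?IHk //; last by lia.
by rewrite exprS_mx !mulmxA.
Qed.

(** When both modules have a nonzero [n]-th power of x, some homomorphism [phi] from N1 to N0 does
    not kill x^n N1. If h does kill it, then h is the limit of [h + t *: phi]. *)
Lemma generic_full_rank_map n d0 d1 e0 e1 (G : triple K e0 e1) :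
  (forall Z : triple K d0 d1,
     in_variety n.+1 Z -> Z.2 *m Z.1.2 ^+ n != 0 -> deg G Z) ->
  forall X : triple K d0 d1, in_variety n.+1 X ->
    X.1.1 ^+ n != 0 -> X.1.2 ^+ n != 0 -> deg G X.
Proof.
move=> GZ [[M0 M1] h] XV /= M0n M1n; have /in_varietyP[/= E0 E1 Eh] := XV.
have [hM|hM] := eqVneq (h *m M1 ^+ n) 0; last exact: GZ.
have [e [v eMv]] := mx_neq0_probe M0n; have [xi [u xMu]] := mx_neq0_probe M1n.
pose phi := ext_pow M0 M1 n.+1 (v *m xi).
have phiM : phi *m M1 ^+ n != 0.
  rewrite ext_pow_mul_exp // !mulmxA -mulmxA; apply: outer_mx_neq0.
    by apply: contraNneq eMv; rewrite -mulmxA => ->; rewrite mulmx0.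
  by apply: contraNneq xMu => ->; rewrite mul0mx.
apply: (@deg_line _ _ _ _ _ _ _ 0 _ _ phi) => t t0; rewrite scaler0 addr0.
apply: GZ => /=.
  apply/in_varietyP; split=> //=.
  by rewrite mulmxDr mulmxDl -scalemxAr -scalemxAl Eh ext_pow_comm.
by rewrite mulmxDl hM add0r -scalemxAl scaler_eq0 negb_or t0.
Qed.


Lemma iso_in_varietyE m d0 d1 e0 e1 (X : triple K d0 d1) (Y : triple K e0 e1) :
  iso X Y -> in_variety m X = in_variety m Y.
Proof.
by move=> XY; apply/idP/idP; apply: iso_in_variety => //; apply: iso_sym.
Qed.

Lemma deg_iso_neq0 d0 d1 e0 e1 a b (G : triple K e0 e1) (X : triple K d0 d1)
    (F : triple K d0 d1 -> 'M[K]_(a, b)) :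
  deg G X -> polyfun_mx (@entry_fun K d0 d1) F -> F X != 0 ->
  exists2 Y : triple K d0 d1, iso G Y & F Y != 0.
Proof.
move=> GX pF FX; have [q [pq qX qF]] := polyfun_mx_neq0 pF FX.
by have [Y GY qY] := zclosure_neq0 GX pq qX; exists Y => //; apply: qF.
Qed.

(** Split P off N0 and replace the rest by a generic triple of the smaller size. Its degree-1 part
    then has a nonzero [n]-th power, and [generic_full_rank_map] finishes. *)
Lemma generic_P_summand n d0 d1 e0 e1 (G : triple K e0 e1) :
  (n < d1)%N -> has_generic n.+1 (d0 - n.+1) d1 ->
  (forall Z : triple K d0 d1,
     in_variety n.+1 Z -> Z.2 *m Z.1.2 ^+ n != 0 -> deg G Z) ->
  forall X : triple K d0 d1, in_variety n.+1 X -> X.1.1 ^+ n != 0 -> deg G X.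
Proof.
move=> nd1 HG GZ X XV X0; have [e [v eMv]] := mx_neq0_probe X0.
have [d0' [X' [dE X'V XX']]] := addP_split XV eMv.
apply: deg_iso (iso_sym XX') _; subst d0.
move: HG; rewrite addKn => -[G' [G'V G'X]].
apply: deg_addP (G'X _ X'V) => Y G'Y.
have YV : in_variety n.+1 Y by rewrite -(iso_in_varietyE _ G'Y).
(* This open condition holds for some point of the smaller variety because [n < d1], hence on the
   generic orbit. *)
have Y1 : Y.1.2 ^+ n != 0.
  have [A [An An1]] := @ex_nilp_index K _ _ nd1.
  have AV : in_variety n.+1 ((0, A, 0) : triple K d0' d1).
    by apply/in_varietyP; rewrite /= exprS_mx !mul0mx An.
  have [Z G'Z Z1] := deg_iso_neq0 (G'X _ AV)
    (polyfun_mx_exp n (@polyfun_mx_X1 K d0' d1)) An1.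
  exact: iso_exp1_neq0 (iso_trans (iso_sym G'Z) G'Y) Z1.
apply: generic_full_rank_map GZ _ (addP_in_variety _ YV) _ Y1.
by rewrite /= diag_block_exp; apply/block_mx_neq0_ul/shift_mx_exp_neq0.
Qed.

(** Move [B] to [B + t *: B'] with [B'] from [ext_pow_step]: the [n]-th power becomes nonzero while
    the next one stays zero. The relation with h is not affected, since the image of h lies in the
    submodule on which x acts by [A]. *)
Lemma generic_extension n a b d1 e0 e1 (G : triple K e0 e1) p q
    (A : 'M[K]_a) (E : 'M[K]_b) B (M1 : 'M[K]_d1) (h : 'M[K]_(a, d1)) :
  (forall Z : triple K (a + b) d1,
     in_variety n.+1 Z -> Z.1.1 ^+ n != 0 -> deg G Z) ->
  in_variety n ((block_mx A B 0 E, M1, col_mx h 0) : triple K (a + b) d1) ->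
  A ^+ p.+1 = 0 -> A ^+ p != 0 -> E ^+ q.+1 = 0 -> E ^+ q != 0 ->
  (n <= p + q.+1)%N -> deg G (block_mx A B 0 E, M1, col_mx h 0).
Proof.
move=> GZ /in_varietyP[/= P0 P1 Ph] Ap0 Ap Eq0 Eq npq.
have := P0; rewrite block_mx_exp -block_mx0 => /eq_block_mx[An Bn _ En].
have Bn1 : ext_pow A E n.+1 B = 0 by rewrite /= Bn En !mulmx0 addr0.
have qn : (q < n)%N.
  by rewrite ltnNge; apply: contra_neqN Eq => nq; apply: expr_mx_eq0 nq En.
have [B' B'n B'n1] := ext_pow_step Ap0 Ap Eq0 Eq En qn npq.
apply: (@deg_line _ _ _ _ _ _ _ (block_mx 0 B' 0 0) _ _ 0) => t t0.
rewrite scaler0 addr0 scale_block_mx !scaler0 add_block_mx !addr0.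
apply: GZ => /=; last first.
  rewrite block_mx_exp; apply: block_mx_neq0_ur.
  by rewrite ext_powD ext_powZ Bn add0r scaler_eq0 negb_or t0.
apply/in_varietyP; split=> /=.
- rewrite block_mx_exp ext_powD ext_powZ Bn1 B'n1 scaler0 addr0.
  by rewrite (exprS_mx A) (exprS_mx E) An En !mulmx0 block_mx0.
- by rewrite exprS_mx P1 mulmx0.
by move: Ph; rewrite !mul_block_col !mulmx0.
Qed.

(** The determinant makes the columns of [h] and [M0 ^+ q *m v] independent. So N1 embeds as a
    submodule, and x^q acts as a nonzero map on the cokernel. A determinant is used because its
    nonvanishing is an open condition. *)
Lemma submodule_form d0 d1 (M0 : 'M[K]_d0) (M1 : 'M[K]_d1) (h : 'M[K]_(d0, d1))
    q (v : 'cV[K]_d0) (L : 'M[K]_(d1 + 1, d0)) :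
  M0 *m h = h *m M1 -> \det (L *m row_mx h (M0 ^+ q *m v)) != 0 ->
  exists u B (E : 'M[K]_u), [/\ (d1 + u = d0)%N, E ^+ q != 0 &
    iso (M0, M1, h) ((block_mx M1 B 0 E, M1, col_mx 1%:M 0) : triple K (d1 + u) d1)].
Proof.
move=> hE; rewrite -unitfE -unitmxE => Lu.
(* Normalized so that the upper rows [R] retract [h], and the last row [eps] vanishes on [h] and is
   1 on [M0 ^+ q *m v]. *)
pose W := invmx (L *m row_mx h (M0 ^+ q *m v)) *m L.
have : W *m row_mx h (M0 ^+ q *m v) = 1%:M by rewrite -mulmxA mulVmx.
rewrite -[W]vsubmxK mul_col_row [1%:M]scalar_mx_block.
move: (usubmx W) (dsubmx W) => R eps /eq_block_mx[Rh _ epsh epsv].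
have [Q [subQ Qh Qfree]] : exists Q : 'M_(\rank (kermx h), d0),
    [/\ forall k (Z : 'M[K]_(k, d0)), Z *m h = 0 -> exists Z', Z = Z' *m Q,
        Q *m h = 0 & row_free Q].
  exists (row_base (kermx h)); split; last exact: row_base_free.
    by move=> k Z ZC; apply/submxP; rewrite eq_row_base; apply/sub_kermxP.
  by apply/sub_kermxP; rewrite eq_row_base.
have [E QE] : exists E, Q *m M0 = E *m Q.
  by apply: subQ; rewrite -mulmxA hE mulmxA Qh mul0mx.
(* The failure of the retraction to commute with x vanishes on the image of [h]; as a map on the
   cokernel it is the cocycle of the extension. *)
have [B BE] : exists B, R *m M0 - M1 *m R = B *m Q.
  by apply: subQ; rewrite mulmxBl -!mulmxA hE Rh mulmxA Rh mul1mx mulmx1 subrr.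
have [eps' epsE] := subQ _ _ epsh.
have rh : \rank h = d1.
  by apply/eqP; rewrite eqn_leq rank_leq_col -{1}(mxrank1 K d1) -Rh mxrankM_maxr.
have dE : (d1 + \rank (kermx h) = d0)%N.
  by rewrite mxrank_ker rh subnKC // -rh rank_leq_row.
have RQfree : row_free (col_mx R Q).
  rewrite -kermx_eq0; apply/rowV0P => w /sub_kermxP.
  rewrite -[w]hsubmxK mul_row_col => wRQ.
  have w0 : lsubmx w = 0.
    have := congr1 (mulmx^~ h) wRQ.
    by rewrite mulmxDl -!mulmxA Qh mulmx0 addr0 mul0mx Rh mulmx1.
  move: wRQ; rewrite w0 mul0mx add0r => wQ.
  suff -> : rsubmx w = 0 by rewrite row_mx0.
  by apply: (row_free_inj Qfree); rewrite wQ mul0mx.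
have [g' RQg] := row_freeP RQfree.
have gRQ : g' *m col_mx R Q = 1%:M.
  clear - dE RQg; move: (col_mx R Q) g' RQg.
  by move: (d1 + _)%N dE => d' dE; subst d' => g g' gg'; apply: mulmx1C.
(* The form [eps] factors through the cokernel, so [E ^+ q = 0] would make it vanish on
   [M0 ^+ q *m v]. *)
exists _, B, E; split=> //.
  apply: contra_eq_neq epsv => Eq0; rewrite epsE mulmxA -(mulmxA eps').
  rewrite -(intertwine_exp q (esym QE)) Eq0 mul0mx mulmx0 mul0mx.
  by rewrite eq_sym; apply: oner_neq0.
exists (col_mx R Q), g', 1%:M, 1%:M.
split; split; rewrite ?mulmx1 ?mul1mx //=.
  by rewrite mul_block_col mul0mx add0r mul_col_mx QE -BE addrC subrK.
by rewrite mul_col_mx Rh Qh.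
Qed.

End Degenerations.

(** * The generic triple *)

Section Existence.
Variable K : closedFieldType.
Implicit Types (n m d e a b c : nat).

(** The identity is an admissible h when [0 < n], so the generic h is invertible and the triple is
    isomorphic to one of the form [(M0, M0, 1%:M)]. Then [M0] is a limit of generic matrices for the
    exponent [n.+1], whose [n]-th power is nonzero because [n < d]. *)
Lemma deg_lift_square n d e0 e1 (G : triple K e0 e1) : (0 < n)%N -> (n < d)%N ->
  has_generic K n d d -> has_generic K n.+1 d 0 ->
  (forall Z : triple K d d, in_variety n.+1 Z -> Z.1.1 ^+ n != 0 -> deg G Z) ->
  forall X : triple K d d, in_variety n X -> deg G X.
Proof.
move=> n0 nd [H [HV HX]] [G0 [G0V G0X]] GZ X XV.
have V1 : in_variety n ((0, 0, 1%:M) : triple K d d).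
  by apply/in_varietyP; rewrite /= expr0n eqn0Ngt n0 mul0mx mulmx0.
have [|[[M0 M1] h] HY /=] := zclosure_neq0 (HX _ V1)
  (polyfun_det (@polyfun_mx_Xh K d d)).
  by rewrite /= det1 oner_eq0.
rewrite -unitfE -unitmxE => hu.
have YV : in_variety n (M0, M1, h) by rewrite -(iso_in_varietyE _ HY).
have /in_varietyP[/= M0n M1n hE] := YV.
apply: deg_through HY _ (HX _ XV).
suff GM : deg G ((M0, M0, 1%:M) : triple K d d).
  apply: deg_iso GM; exists 1%:M, 1%:M, (invmx h), h.
  split; split; rewrite /= ?mulmx1 ?mul1mx ?mulmxV ?mulVmx //.
  by rewrite -{1}[M1](mulKmx hu) -hE !mulmxA mulmxK.
have MV : in_variety n.+1 ((M0, 0, 0) : triple K d 0).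
  by apply/in_varietyP; rewrite /= !exprS_mx M0n !mulmx0 !mul0mx.
(* This polynomial map carries a degeneration of a single matrix to one of triples with h the
   identity. *)
apply: (@deg_map K d d _ _ d 0 _ _ _ _ (fun Z => (Z.1.1, Z.1.1, 1%:M)))
  (G0X _ MV) => /= [|||Z G0Z].
- exact: polyfun_mx_X0.
- exact: polyfun_mx_X0.
- exact: polyfun_mx_cst.
have := G0V; rewrite (iso_in_varietyE _ G0Z) => /in_varietyP[Z0 _ _].
apply: GZ; first by apply/in_varietyP; rewrite /= mulmx1 mul1mx.
have [A [An An1]] := @ex_nilp_index K _ _ nd.
have AV : in_variety n.+1 ((A, 0, 0) : triple K d 0).
  by apply/in_varietyP; rewrite /= An exprS_mx !mul0mx mulmx0.
have [Y G0Y Y0] := deg_iso_neq0 (G0X _ AV)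
  (polyfun_mx_exp n (@polyfun_mx_X0 K d 0)) An1.
exact: iso_exp0_neq0 (iso_trans (iso_sym G0Y) G0Z) Y0.
Qed.

(** Generically h is injective, with N1 and the cokernel of the largest possible nilpotency indices.
    This puts the triple into the form required by [generic_extension]. *)
Lemma deg_lift_mono n d0 d1 e0 e1 (G : triple K e0 e1) :
  (0 < n)%N -> (n < d0)%N -> (0 < d1 < d0)%N -> has_generic K n d0 d1 ->
  (forall Z : triple K d0 d1,
     in_variety n.+1 Z -> Z.1.1 ^+ n != 0 -> deg G Z) ->
  forall X : triple K d0 d1, in_variety n X -> deg G X.
Proof.
move=> n0 nd /andP[d1_gt0 d10].
have [u u_gt0 dE] : exists2 u, (0 < u)%N & (d1 + u = d0)%N.
  by exists (d0 - d1)%N; rewrite ?subn_gt0 // subnKC // ltnW.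
case=> H [HV HX] GZ X XV; subst d0.
(* The largest exponents with a possibly nonzero power on N1 and on the cokernel. From [n < d1 + u]
   follows [n <= p + q.+1]. *)
pose p := (minn n d1).-1; pose q := (minn n u).-1.
have pE : p.+1 = minn n d1 by rewrite prednK // leq_min n0.
have qE : q.+1 = minn n u by rewrite prednK // leq_min n0.
have [|A [Ap0 Ap]] := @ex_nilp_index K p d1; first by rewrite pE geq_minr.
have [|U [Uq0 Uq]] := @ex_nilp_index K q u; first by rewrite qE geq_minr.
have [eps [w eUw]] := mx_neq0_probe Uq.
(* A test point at which all the required open conditions hold; [L] and [v] below are chosen to make
   the matrix in [F X1] block diagonal. *)
pose X1 : triple K (d1 + u) d1 := (block_mx A 0 0 U, A, col_mx 1%:M 0).
have X1V : in_variety n X1.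
  have An : A ^+ n = 0 by apply: expr_mx_eq0 Ap0; rewrite pE geq_minl.
  have Un : U ^+ n = 0 by apply: expr_mx_eq0 Uq0; rewrite qE geq_minl.
  apply/in_varietyP; rewrite /= diag_block_exp An Un block_mx0; split=> //.
  by rewrite mul_block_col mul_col_mx !mulmx1 mul1mx !mul0mx !mulmx0 !addr0.
pose L : 'M[K]_(d1 + 1, d1 + u) := block_mx 1%:M 0 0 eps.
pose v : 'cV[K]_(d1 + u) := col_mx 0 w.
pose F (Y : triple K (d1 + u) d1) := \det (L *m row_mx Y.2 (Y.1.1 ^+ q *m v)).
have pF : polyfun (@entry_fun K _ _) F.
  apply: polyfun_det; apply: polyfun_mx_mul (polyfun_mx_cst _ _) _.
  apply: polyfun_mx_row; first exact: polyfun_mx_Xh.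
  exact: polyfun_mx_mul (polyfun_mx_exp _ (@polyfun_mx_X0 _ _ _)) (polyfun_mx_cst _ _).
have [f [pf fX fF]] := @polyfun_mx_neq0 _ _ _ _ _ _ X1
  (polyfun_mx_exp p (@polyfun_mx_X1 K (d1 + u) d1)) Ap.
have FX : F X1 != 0.
  rewrite /F /X1 /= diag_block_exp mul_block_col !mulmx0 mul0mx !add0r.
  rewrite -[row_mx _ _]/(row_mx (col_mx 1%:M 0) (col_mx 0 (U ^+ q *m w))).
  rewrite -block_mxEh mulmx_block !(mul0mx, mulmx0, addr0, add0r) mulmx1.
  rewrite det_ublock det1 mul1r mulmxA [eps *m _ *m w]mx11_scalar det_scalar1.
  by apply: contraNneq eUw => eUw0; rewrite [_ *m w]mx11_scalar eUw0 raddf0.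
have [|[[M0 M1] h] HY] := zclosure_neq0 (HX _ X1V) (polyfun_mul pf pF).
  by rewrite mulf_neq0.
rewrite mulf_eq0 negb_or => /andP[/fF /= M1p FY].
have YV : in_variety n (M0, M1, h) by rewrite -(iso_in_varietyE _ HY).
have /in_varietyP[/= M0n M1n hE] := YV.
have [u' [B [E [uE Eq YY']]]] := submodule_form hE FY.
have {uE} uE : u' = u by apply: (addnI uE).
subst u'; apply: deg_through (iso_trans HY YY') _ (HX _ XV).
have Y'V := iso_in_variety YY' YV.
have /in_varietyP[/= + _ _] := Y'V.
rewrite block_mx_exp -block_mx0 => /eq_block_mx[_ _ _ En].
apply: (generic_extension GZ Y'V _ M1p _ Eq).
- by rewrite pE; case: leqP => _; rewrite ?M1n // (nilp_exp_dim M1n).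
- by rewrite qE; case: leqP => _; rewrite ?En // (nilp_exp_dim En).
- by lia.
Qed.

(** A generic module for the exponent [n] has a summand K[x]/(x^n), and its complement is nonzero
    because [n < d]. The direct sum is a split extension, which [generic_extension] deforms. *)
Lemma deg_lift_single n d e0 e1 (G : triple K e0 e1) : (0 < n)%N -> (n < d)%N ->
  has_generic K n d 0 ->
  (forall Z : triple K d 0, in_variety n.+1 Z -> Z.1.1 ^+ n != 0 -> deg G Z) ->
  forall X : triple K d 0, in_variety n X -> deg G X.
Proof.
case: n => // n _ nd [H [HV HX]] GZ X XV.
have [|A [An An1]] := @ex_nilp_index K n d; first exact: ltnW.
have AV : in_variety n.+1 ((A, 0, 0) : triple K d 0).
  by apply/in_varietyP; rewrite /= An exprS_mx !mul0mx mulmx0.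
have [Y HY Y0] := deg_iso_neq0 (HX _ AV)
  (polyfun_mx_exp n (@polyfun_mx_X0 K d 0)) An1.
have YV : in_variety n.+1 Y by rewrite -(iso_in_varietyE _ HY).
have [e [v eMv]] := mx_neq0_probe Y0.
have [d' [Y' [dE Y'V YY']]] := addP_split YV eMv.
subst d; have d'_gt0 : (0 < d')%N by rewrite -(ltn_add2l n.+1) addn0.
apply: deg_through (iso_trans HY YY') _ (HX _ XV).
have Y''V := iso_in_variety YY' YV.
have /in_varietyP[Y'0 _ _] := Y'V.
have [q Eq0 Eq] := nilp_index Y'0 d'_gt0.
move: Y''V; rewrite /addP.
have -> : col_mx (krylov_rows n.+1 (e *m Y.2) Y'.1.2) Y'.2 = col_mx 0 0.
  by rewrite [LHS]thinmx0 [RHS]thinmx0.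
move=> Y''V; apply: (generic_extension GZ Y''V (shift_mx_nilp _ _)
  (shift_mx_exp_neq0 _ _) Eq0 Eq).
by rewrite addnS ltnS leq_addr.
Qed.

Lemma deg_lift n d0 d1 e0 e1 (G : triple K e0 e1) :
  (0 < n)%N -> (n < d0)%N -> (d1 <= d0)%N -> has_generic K n d0 d1 ->
  (d1 = d0 -> has_generic K n.+1 d0 0) ->
  (forall Z : triple K d0 d1,
     in_variety n.+1 Z -> Z.1.1 ^+ n != 0 -> deg G Z) ->
  forall X : triple K d0 d1, in_variety n X -> deg G X.
Proof.
move=> n0 nd; rewrite leq_eqVlt => /predU1P[-> HG /(_ erefl)|d10 HG _].
  exact: deg_lift_square.
case: (posnP d1) => [d1E|d1_gt0]; last by apply: deg_lift_mono; rewrite ?d1_gt0.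
by subst d1; apply: deg_lift_single.
Qed.

(** Since [d1 <= d0], the generic h has a left inverse, so the component from N1 to P can be
    cancelled by choosing another retraction onto a copy of P. Hence the form [0] suffices. *)
Lemma generic_big_cokernel n d0 d1 (G : triple K d0 d1) : (d1 <= d0)%N ->
  in_variety n.+1 G ->
  (forall X : triple K d0 d1, in_variety n.+1 X -> deg G X) ->
  forall Z : triple K (n.+1 + d0) d1,
    in_variety n.+1 Z -> Z.1.1 ^+ n != 0 -> deg (addP n 0 G) Z.
Proof.
move=> /subnKC dE GV GX Z ZV /mx_neq0_probe[e [v eMv]].
have [d0' [X' [/addnI dE' X'V ZX']]] := addP_split ZV eMv.
apply: deg_iso (iso_sym ZX') _; subst d0'.
apply: deg_addP (GX _ X'V) => Y GY.
have YV : in_variety n.+1 Y by rewrite -(iso_in_varietyE _ GY).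
have [L LY] : exists L, L *m Y.2 = 1%:M.
  move: (d0 - d1)%N dE => u dE; subst d0.
  have IV : in_variety n.+1 ((0, 0, col_mx 1%:M 0) : triple K (d1 + u) d1).
    by apply/in_varietyP; rewrite /= !exprS_mx !mul0mx mulmx0.
  have := zclosure_neq0 (GX _ IV) (polyfun_det (polyfun_mx_mul
    (polyfun_mx_cst _ (row_mx 1%:M 0)) (@polyfun_mx_Xh K (d1 + u) d1))).
  case=> [|W GW].
    by rewrite /= mul_row_col mulmx1 mulmx0 addr0 det1 oner_eq0.
  rewrite -unitfE -unitmxE => Wu.
  have [g0 [g0' [g1 [g1' [[_ E2 E3 _] [_ _ F3]]]]]] := iso_trans (iso_sym GW) GY.
  exists (g1 *m invmx (row_mx 1%:M 0 *m W.2) *m row_mx 1%:M 0 *m g0').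
  have -> : Y.2 = g0 *m W.2 *m g1' by rewrite -F3 -mulmxA E3 mulmx1.
  rewrite -!mulmxA (mulmxA g0') E2 mul1mx.
  by rewrite (mulmxA (row_mx _ _)) mulKmx.
have J0 := shift_mx_exp_neq0 K n; have [e1 [v1 eJv]] := mx_neq0_probe J0.
set xi := e *m Z.2.
have XV := addP_in_variety xi YV.
(* It agrees with [e1] on P, so it still detects the socle of P, and its second part is chosen to
   make it vanish on the image of N1. *)
pose e2 := row_mx e1 (- (e1 *m krylov_rows n.+1 xi Y.1.2 *m L)).
have e2h : e2 *m (addP n xi Y).2 = 0.
  by rewrite mul_row_col mulNmx -[_ *m L *m _]mulmxA LY mulmx1 subrr.
have [|d0' [X'' [/addnI dE' X''V XX'']]] := @addP_split _ _ _ _ _ e2 (col_mx v1 0) XV.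
  rewrite /= diag_block_exp mul_row_block mul_row_col !mulmx0 addr0.
  by rewrite addr0.
apply: deg_iso (iso_sym XX'') _; rewrite e2h; subst d0'.
apply: deg_addP (GX _ X''V) => W GW.
have [xi' [GW' _ /(_ erefl) xi'0]] := iso_addP n 0 GW.
by move: GW'; rewrite xi'0; apply: iso_deg.
Qed.

Lemma krylov_rowsD k d (e f : 'rV[K]_d) M :
  krylov_rows k (e + f) M = krylov_rows k e M + krylov_rows k f M.
Proof. by apply/row_matrixP => i; rewrite [RHS]raddfD /= !rowK mulmxDl. Qed.

Lemma krylov_rowsZ k d t (e : 'rV[K]_d) M :
  krylov_rows k (t *: e) M = t *: krylov_rows k e M.
Proof. by apply/row_matrixP => i; rewrite [RHS]linearZ /= !rowK -scalemxAl. Qed.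

(** A polynomial in [M] with coefficients in decreasing degree, matching the row order of
    [krylov_rows]; [c 0 ord_max] is the constant term. *)
Definition krylov_poly r d (c : 'rV[K]_r.+1) (M : 'M[K]_d) : 'M_d :=
  \sum_(i < r.+1) c 0 i *: M ^+ (r - i).

Lemma krylov_poly_comm r a b (c : 'rV[K]_r.+1) (A : 'M[K]_a) (E : 'M[K]_b) h :
  A *m h = h *m E -> krylov_poly c A *m h = h *m krylov_poly c E.
Proof.
move=> hE; rewrite mulmx_suml mulmx_sumr; apply: eq_bigr => i _.
by rewrite -scalemxAl -scalemxAr (intertwine_exp _ hE).
Qed.

Lemma krylov_poly_mul r d (c : 'rV[K]_r.+1) (M : 'M[K]_d) (w : 'rV_d) :
  w *m M = 0 -> w *m krylov_poly c M = c 0 ord_max *: w.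
Proof.
move=> wM; rewrite mulmx_sumr big_ord_recr /= big1 => [|i _].
  by rewrite subnn expr0 -scalemxAr mulmx1 add0r.
have /subnSK <- := ltn_ord i.
by rewrite -scalemxAr exprS_mx mulmxA wM mul0mx scaler0.
Qed.

(** If [w] is in the left kernel, then [w *m M ^+ k = 0] by descending induction on [k]: a vector
    killed by [M] is merely scaled by the constant term. *)
Lemma krylov_poly_unit r d m (c : 'rV[K]_r.+1) (M : 'M[K]_d) :
  M ^+ m = 0 -> c 0 ord_max != 0 -> krylov_poly c M \in unitmx.
Proof.
move=> Mm c0; rewrite -row_free_unit -kermx_eq0; apply/rowV0P => w /sub_kermxP wq.
suff wM k : w *m M ^+ k = 0 by rewrite -[w]mulmx1 -(wM 0%N) expr0.
have [mk|/ltnW km] := leqP m k; first by rewrite (expr_mx_eq0 mk Mm) mulmx0.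
rewrite -(subKn km); elim: (m - k)%N => [|j IHj].
  by rewrite subn0 Mm mulmx0.
have [mj|jm] := leqP m j; first by rewrite (_ : m - j.+1 = m - j)%N //; lia.
have wMM : w *m M ^+ (m - j.+1) *m M = 0.
  by rewrite -mulmxA -exprSr_mx subnSK.
have : w *m M ^+ (m - j.+1) *m krylov_poly c M = 0.
  rewrite -mulmxA -(@krylov_poly_comm _ _ _ c M M) ?mulmxA ?wq ?mul0mx //.
  by rewrite -exprS_mx exprSr_mx.
by rewrite krylov_poly_mul // => /eqP; rewrite scaler_eq0 (negPf c0) => /eqP.
Qed.

(* The linear forms on a cyclic module are the multiples of any form that does not
   vanish on the socle; two such forms differ by a unit of [K[x]/(x^n.+1)]. *)
Lemma iso_addP_cyclic n d0 r (xi xi' : 'rV[K]_r.+1) (Y : triple K d0 r.+1) :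
  in_variety n.+1 Y -> xi *m Y.1.2 ^+ r != 0 -> xi' *m Y.1.2 ^+ r != 0 ->
  iso (addP n xi' Y) (addP n xi Y).
Proof.
case: Y => [[N0 N1] h] /in_varietyP[/= N0n N1n hE] xiN xi'N.
have N1r := nilp_exp_dim N1n.
have Ru : krylov_rows r.+1 xi N1 \in unitmx.
  have [e [v xNv]] := mx_neq0_probe xiN.
  have xNv' : xi *m N1 ^+ r *m v != 0.
    by apply: contraNneq xNv; rewrite -(mulmxA e) => ->; rewrite mulmx0.
  by have := krylov_pairing_unit N1r xNv'; rewrite unitmx_mul => /andP[].
pose c := xi' *m invmx (krylov_rows r.+1 xi N1).
have xi'E : xi' = xi *m krylov_poly c N1.
  rewrite -[LHS](mulmxKV Ru) -/c mulmx_sum_row mulmx_sumr.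
  by apply: eq_bigr => i _; rewrite rowK -scalemxAr.
have c0 : c 0 ord_max != 0.
  have qN : krylov_poly c N1 *m N1 ^+ r = N1 ^+ r *m krylov_poly c N1.
    by apply: krylov_poly_comm; rewrite -exprS_mx exprSr_mx.
  apply: contraNneq xi'N => c0; rewrite xi'E -mulmxA qN mulmxA.
  rewrite krylov_poly_mul ?c0 ?scale0r //.
  by rewrite -mulmxA -exprSr_mx N1r mulmx0.
(* The same polynomial acts invertibly on both modules and commutes with h, so it is an automorphism
   of the triple; on N1 it turns [xi] into [xi']. *)
have u0 := krylov_poly_unit N0n c0; have u1 := krylov_poly_unit N1n c0.
exists (block_mx 1%:M 0 0 (krylov_poly c N0)).
exists (block_mx 1%:M 0 0 (invmx (krylov_poly c N0))).
exists (krylov_poly c N1), (invmx (krylov_poly c N1)).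
split; split; rewrite ?diag1_mul ?mulmxV ?mulVmx //=.
- rewrite !mulmx_block !(mul0mx, mulmx0, addr0, add0r) mulmx1 mul1mx.
  by rewrite (@krylov_poly_comm _ _ _ c N0 N0 N0).
- by rewrite (@krylov_poly_comm _ _ _ c N1 N1 N1).
rewrite mul_block_col !(mul0mx, mulmx0, addr0, add0r) mul1mx mul_col_mx.
rewrite (@krylov_rows_mul _ _ _ _ _ _ N1) -?xi'E.
  by rewrite (krylov_poly_comm c hE).
by rewrite (@krylov_poly_comm _ _ _ c N1 N1 N1).
Qed.

(** The hypothesis on [xi0] makes the degree-1 part of [G] cyclic, so all forms that do not vanish
    on its socle give isomorphic triples. A form vanishing there is a limit of such forms. *)
Lemma generic_small_cokernel n d0 r (G : triple K d0 r.+1) (xi0 : 'rV[K]_r.+1) :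
  (r < n.+1)%N -> in_variety n.+1 G ->
  (forall X : triple K d0 r.+1, in_variety n.+1 X -> deg G X) ->
  xi0 *m G.1.2 ^+ r != 0 ->
  forall Z : triple K (n.+1 + d0) r.+1,
    in_variety n.+1 Z -> Z.1.1 ^+ n != 0 -> deg (addP n xi0 G) Z.
Proof.
move=> rn GV GX xi0G Z ZV /mx_neq0_probe[e [v eMv]].
have [d0' [X' [/addnI dE' X'V ZX']]] := addP_split ZV eMv.
apply: deg_iso (iso_sym ZX') _; subst d0'.
apply: deg_addP (GX _ X'V) => Y GY; set xi := e *m Z.2.
have YV : in_variety n.+1 Y by rewrite -(iso_in_varietyE _ GY).
have [xi1 [GY1 /(_ r xi0G) xi1Y _]] := iso_addP n xi0 GY.
have Gxi xi' : xi' *m Y.1.2 ^+ r != 0 -> deg (addP n xi0 G) (addP n xi' Y).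
  move=> xi'Y; apply: iso_deg; apply: iso_trans GY1 _.
  exact: iso_addP_cyclic.
have [xiY|/Gxi //] := eqVneq (xi *m Y.1.2 ^+ r) 0.
apply: (@deg_line _ _ _ _ _ _ _ 0 _ _ (col_mx (krylov_rows n.+1 xi1 Y.1.2) 0)) => t t0.
have := Gxi (xi + t *: xi1); rewrite /addP krylov_rowsD krylov_rowsZ.
rewrite scaler0 addr0 scale_col_mx scaler0 add_col_mx addr0; apply.
by rewrite mulmxDl xiY add0r -scalemxAl scaler_eq0 negb_or t0.
Qed.

Lemma has_generic_trivial m : has_generic K m 0 0.
Proof.
exists (0, 0, 0); split.
  by apply/in_varietyP; split; rewrite /= [LHS]thinmx0 [RHS]thinmx0.
move=> [[M0 M1] h] _; apply: iso_deg.
by rewrite (thinmx0 M0) (thinmx0 M1) (thinmx0 h); apply: iso_refl.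
Qed.

(** A nilpotent matrix of size at most [n] has zero [n]-th power, so the exponents [n] and [n.+1]
    define the same variety. *)
Lemma has_genericS n d0 d1 : (d0 <= n)%N -> (d1 <= n)%N ->
  has_generic K n d0 d1 -> has_generic K n.+1 d0 d1.
Proof.
move=> d0n d1n [G [GV GX]]; exists G; split.
  by case/in_varietyP: GV => G0 G1 Gh; apply/in_varietyP; rewrite !exprS_mx G0 G1 !mulmx0.
move=> X /in_varietyP[X0 X1 Xh]; apply: GX; apply/in_varietyP; split=> //.
  exact: expr_mx_eq0 d0n (nilp_exp_dim X0).
exact: expr_mx_eq0 d1n (nilp_exp_dim X1).
Qed.

(** Common end of all cases: once the points with a nonzero [n]-th power are handled, the others
    satisfy the equations for the exponent [n], where [deg_lift] applies. *)
Lemma has_generic_of_P n d0 d1 (G : triple K d0 d1) : (n < d0)%N -> (d1 <= d0)%N ->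
  ((0 < n)%N -> has_generic K n d0 d1) -> (d1 = d0 -> has_generic K n.+1 d0 0) ->
  in_variety n.+1 G ->
  (forall X : triple K d0 d1, in_variety n.+1 X -> X.1.1 ^+ n != 0 -> deg G X) ->
  (forall X : triple K d0 d1, in_variety n.+1 X -> X.1.2 ^+ n != 0 -> deg G X) ->
  has_generic K n.+1 d0 d1.
Proof.
move=> nd0 d10 IHn IH0 GV G0 G1; exists G; split=> // X XV.
have [X0|] := eqVneq (X.1.1 ^+ n) 0; last exact: G0.
have [X1|] := eqVneq (X.1.2 ^+ n) 0; last exact: G1.
(* For [n = 0] the vanishing power would be the identity of a nonzero space. *)
have n_gt0 : (0 < n)%N.
  case: n {IHn IH0 GV G0 G1 X1 XV} nd0 X0 => // d0_gt0 /eqP.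
  by case: d0 d10 G X d0_gt0 => // d0 _ _ X _; rewrite expr0 oner_eq0.
apply: (deg_lift n_gt0 nd0 d10 (IHn n_gt0) IH0 G0).
by have /in_varietyP[_ _ Xh] := XV; apply/in_varietyP.
Qed.

Lemma has_generic_all m d0 d1 : (0 < m)%N -> has_generic K m d0 d1.
Proof.
elim: m d0 d1 => // n IHn d0 d1 _.
have [s] := ubnP (d0 + d1)%N; elim: s d0 d1 => // s IHs d0 d1.
wlog d10 : d0 d1 / (d1 <= d0)%N => [wlog|ds].
  have [/wlog //|/ltnW d01 ds] := leqP d1 d0.
  by apply/has_generic_dualize/wlog; rewrite // addnC.
have [d0n|] := leqP d0 n.
  have [n0|n_gt0] := posnP n.
    move: d0n d10; rewrite n0 leqn0 => /eqP ->; rewrite leqn0 => /eqP ->.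
    exact: has_generic_trivial.
  by apply: has_genericS => //; [apply: leq_trans d0n|apply: IHn].
move=> nd0; have [e0 d0E] : exists e0, (d0 = n.+1 + e0)%N.
  by exists (d0 - n.+1)%N; rewrite subnKC.
subst d0.
have IHn' : (0 < n)%N -> has_generic K n (n.+1 + e0) d1 by apply: IHn.
have IH0 : d1 = (n.+1 + e0)%N -> has_generic K n.+1 (n.+1 + e0) 0.
  by move=> d1E; apply: IHs; lia.
(* If [n < d1], both modules can contain P, and the generic triple is obtained by adding the
   identity of P. *)
have [nd1|d1n] := ltnP n d1.
  have [e1 d1E] : exists e1, (d1 = n.+1 + e1)%N.
    by exists (d1 - n.+1)%N; rewrite subnKC.
  subst d1; have [|G [GV GX]] := IHs e0 e1; first by lia.
  have GPP (Z : triple K (n.+1 + e0) (n.+1 + e1)) :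
      in_variety n.+1 Z -> Z.2 *m Z.1.2 ^+ n != 0 -> deg (addPP n G) Z.
    move=> ZV Zh; have [d0' [d1' [X [/addnI E0 /addnI E1 XV ZX]]]] := addPP_split ZV Zh.
    by subst d0' d1'; apply: deg_iso (iso_sym ZX) _; apply/deg_addPP/GX.
  apply: (has_generic_of_P nd0 d10 IHn' IH0 (addPP_in_variety GV)).
    by apply: generic_P_summand GPP => //; rewrite addKn; apply: IHs; lia.
  move=> X XV X1; rewrite -[G in addPP n G]dualizeK -[X]dualizeK.
  have : deg (dualize (addPP n G)) (dualize X).
    (* A nonzero [n]-th power on N1 becomes one in degree 0 after dualizing. *)
    apply: (@generic_P_summand _ n _ _ _ _ _ nd0 _ _ _ (dualize_in_variety XV)).
    - by rewrite addKn; apply/has_generic_dualize/IHs; lia.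
    - move=> Z ZV Zh; rewrite -[Z]dualizeK; apply: deg_dualize; apply: GPP.
        exact: dualize_in_variety.
      have /in_varietyP[_ _ ZE] := ZV.
      rewrite /= -trmx_exp -trmx_mul (intertwine_exp _ ZE).
      by apply: contraNneq Zh => /(congr1 trmx); rewrite trmxK trmx0 => ->.
    rewrite /= -trmx_exp; apply: contraNneq X1 => /(congr1 trmx).
    by rewrite trmxK trmx0 => ->.
  by move/deg_dualize; rewrite !dualizeK.
have X1n (Z : triple K (n.+1 + e0) d1) : in_variety n.+1 Z -> Z.1.2 ^+ n = 0.
  by case/in_varietyP=> _ Z1 _; apply: expr_mx_eq0 d1n (nilp_exp_dim Z1).
have [|G [GV GX]] := IHs e0 d1; first by lia.
(* Now N1 is too small to contain P. The size of the rest of N0 decides whether the form on N1 can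
   be made zero or must be kept general. *)
have [d1e|] := leqP d1 e0.
  apply: (has_generic_of_P nd0 d10 IHn' IH0 (addP_in_variety 0 GV)).
    exact: generic_big_cokernel.
  by move=> X XV; rewrite X1n ?eqxx.
case: d1 {IHn' IH0} d10 ds d1n X1n G GV GX => // r d10 ds d1n X1n G GV GX e0r.
have [A [An An1]] := @ex_nilp_index K r r.+1 (ltnSn r).
have AV : in_variety n.+1 ((0, A, 0) : triple K e0 r.+1).
  apply/in_varietyP; rewrite /= exprS_mx !mul0mx.
  by rewrite (expr_mx_eq0 _ An) // ltnW.
have [Y GY Y1] := deg_iso_neq0 (GX _ AV)
  (polyfun_mx_exp r (@polyfun_mx_X1 K e0 r.+1)) An1.
have G1 : G.1.2 ^+ r != 0 by apply: iso_exp1_neq0 (iso_sym GY) Y1.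
have [xi [v xGv]] := mx_neq0_probe G1.
have xG : xi *m G.1.2 ^+ r != 0 by apply: contraNneq xGv => ->; rewrite mul0mx.
apply: (@has_generic_of_P _ _ _ (addP n xi G) nd0 d10).
- by move=> n_gt0; apply: IHn.
- by move=> E; exfalso; lia.
- exact: addP_in_variety.
- by apply: generic_small_cokernel => //; apply: ltnW.
by move=> X XV; rewrite X1n ?eqxx.
Qed.

End Existence.

(** * Openness of a dense orbit *)

Section OpenOrbit.
Variable K : closedFieldType.
Variables (m d0 d1 : nat).
Implicit Types G X Y Z : triple K d0 d1.

(* The left kernel of [hom_mx G Z] is the space of homomorphisms from [G] to [Z]. *)
Definition hom_mx G Z :=
  row_mx (row_mx (col_mx (lin_mulmxr G.1.1 - lin_mulmx Z.1.1) 0)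
                 (col_mx 0 (lin_mulmxr G.1.2 - lin_mulmx Z.1.2)))
         (col_mx (lin_mulmxr G.2) (- lin_mulmx Z.2)).

Lemma hom_mx_eq0 G Z (a : 'M_d0) (b : 'M_d1) :
  row_mx (mxvec a) (mxvec b) *m hom_mx G Z = 0 <->
  [/\ Z.1.1 *m a = a *m G.1.1, Z.1.2 *m b = b *m G.1.2 & Z.2 *m b = a *m G.2].
Proof.
rewrite !mul_mx_row !mul_row_col !mulmx0 addr0 add0r !mulmxBr mulmxN.
rewrite !mul_vec_lin /= -!linearB; split=> [/eqP|[-> -> ->]]; last first.
  by rewrite !subrr !linear0 !row_mx0.
by rewrite !row_mx_eq0 !mxvec_eq0 !subr_eq0 -andbA => /and3P[/eqP-> /eqP-> /eqP->].
Qed.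

Lemma polyfun_mx_lin_mulmx T (B : (T -> K) -> Prop) a b c (F : T -> 'M[K]_(a, b)) :
  polyfun_mx B F -> polyfun_mx B (fun x => lin_mulmx (F x) : 'M_(b * c, a * c)).
Proof.
move=> pF i j; case: (mxvec_indexP j) => k l.
apply: eq_polyfun (polyfun_mx_mul pF (polyfun_mx_cst B (vec_mx (delta_mx 0 i))) k l).
by move=> x; rewrite [RHS]mxE /= mxvecE.
Qed.

Lemma polyfun_hom_mx G : polyfun_mx (@entry_fun K d0 d1) (hom_mx G).
Proof.
have cst := @polyfun_mx_cst K _ (@entry_fun K d0 d1).
apply: polyfun_mx_row; first apply: polyfun_mx_row.
- apply: polyfun_mx_col; last exact: cst.
  apply: polyfun_mx_sub; first exact: cst.
  exact/polyfun_mx_lin_mulmx/polyfun_mx_X0.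
- apply: polyfun_mx_col; first exact: cst.
  apply: polyfun_mx_sub; first exact: cst.
  exact/polyfun_mx_lin_mulmx/polyfun_mx_X1.
apply: polyfun_mx_col; first exact: cst.
move=> i j; apply: eq_polyfun (polyfun_mx_sub (cst _ _ 0)
  (polyfun_mx_lin_mulmx (@polyfun_mx_Xh K d0 d1)) i j) => x.
by rewrite sub0r.
Qed.

(** Composition with the isomorphism embeds the endomorphisms of [G] into the homomorphisms from [G]
    to [Y], and a larger left kernel means a smaller rank. *)
Lemma rank_hom_mx G Y : iso G Y -> (\rank (hom_mx G Y) <= \rank (hom_mx G G))%N.
Proof.
case=> g0 [g0' [g1 [g1' [[_ E0 _ E1] [F0 F1 Fh]]]]].
pose P : 'M[K]_(d0 * d0 + d1 * d1) := block_mx (lin_mulmx g0) 0 0 (lin_mulmx g1).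
have vP a b : row_mx (mxvec a) (mxvec b) *m P =
    row_mx (mxvec (g0 *m a)) (mxvec (g1 *m b)).
  by rewrite mul_row_block !mulmx0 addr0 add0r !mul_vec_lin.
have vecK (w : 'rV[K]_(d0 * d0 + d1 * d1)) :
    w = row_mx (mxvec (vec_mx (lsubmx w))) (mxvec (vec_mx (rsubmx w))).
  by rewrite !vec_mxK hsubmxK.
have Pfree : row_free P.
  rewrite -kermx_eq0; apply/rowV0P => w /sub_kermxP; rewrite [w]vecK vP => /eqP.
  rewrite row_mx_eq0 !mxvec_eq0 => /andP[/eqP g0w /eqP g1w].
  rewrite -[vec_mx (lsubmx w)]mul1mx -E0 -[vec_mx (rsubmx w)]mul1mx -E1 -!mulmxA.
  by rewrite g0w g1w !mulmx0 !linear0 row_mx0.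
have : (kermx (hom_mx G G) *m P <= kermx (hom_mx G Y))%MS.
  apply/sub_kermxP/row_matrixP => i; rewrite row0 2!row_mul.
  have : row i (kermx (hom_mx G G)) *m hom_mx G G = 0.
    by rewrite -row_mul mulmx_ker row0.
  rewrite [row i _]vecK vP; move: (vec_mx _) (vec_mx _) => b a.
  move=> /hom_mx_eq0[H0 H1 Hh]; apply/hom_mx_eq0.
  by rewrite !mulmxA F0 F1 Fh -!mulmxA H0 H1 Hh.
move/mxrankS; rewrite mxrankMfree // !mxrank_ker.
by move: (rank_leq_row (hom_mx G G)) (rank_leq_row (hom_mx G Y)); lia.
Qed.

(* Cramer's rule extends the identity of [G] to a homomorphism from [G] to [Z]
   depending polynomially on [Z]; where its determinant is nonzero, [Z] lies in the
   orbit of [G]. *)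
Lemma dense_orbit_open G : (forall X, in_variety m X -> deg G X) ->
  exists q, [/\ polyfun (@entry_fun K d0 d1) q, q G != 0 &
    forall Z, in_variety m Z -> q Z != 0 -> iso G Z].
Proof.
move=> GX; pose rho := \rank (hom_mx G G).
have [L rowL] := row_freeP (row_base_free (hom_mx G G)).
have [R Rcol] := row_fullP (col_base_full (hom_mx G G)).
(* [R] and [L] compress [hom_mx G Z] to a square matrix [D Z] of size [rho], which is the identity
   at [G]. *)
have RL : R *m hom_mx G G *m L = 1%:M.
  have : R *m (col_base (hom_mx G G) *m row_base (hom_mx G G)) *m L = 1%:M.
    by rewrite mulmxA Rcol mul1mx rowL.
  by rewrite mulmx_base.
pose D Z := R *m hom_mx G Z *m L.
pose v0 : 'rV[K]_(d0 * d0 + d1 * d1) := row_mx (mxvec 1%:M) (mxvec 1%:M).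
pose v Z := \det (D Z) *: v0 - v0 *m hom_mx G Z *m L *m \adj (D Z) *m R.
have cst := @polyfun_mx_cst K _ (@entry_fun K d0 d1).
have pA := polyfun_hom_mx G.
have pD : polyfun_mx (@entry_fun K d0 d1) D.
  by apply: polyfun_mx_mul => //; apply: polyfun_mx_mul.
have pdD := polyfun_det pD.
have pv : polyfun_mx (@entry_fun K d0 d1) v.
  apply: polyfun_mx_sub; first exact: polyfun_mx_scale.
  apply: polyfun_mx_mul => //; apply: polyfun_mx_mul; last exact: polyfun_mx_adj.
  by apply: polyfun_mx_mul => //; apply: polyfun_mx_mul.
have v_orbit Y : iso G Y -> \det (D Y) != 0 -> v Y *m hom_mx G Y = 0.
  move=> GY DY; have vAL : v Y *m (hom_mx G Y *m L) = 0.
    rewrite mulmxBl -scalemxAl -[_ *m R *m _]mulmxA [R *m _]mulmxA.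
    rewrite -[_ *m \adj _ *m _]mulmxA mul_adj_mx mul_mx_scalar mulmxA subrr //.
  apply/sub_kermxP; apply: submx_trans (introT sub_kermxP vAL) _.
  have kAL : (kermx (hom_mx G Y) <= kermx (hom_mx G Y *m L))%MS.
    by apply/sub_kermxP; rewrite mulmxA mulmx_ker mul0mx.
  rewrite -(geq_leqif (mxrank_leqif_sup kAL)) !mxrank_ker leq_sub2l //.
  apply: leq_trans (rank_hom_mx GY) _.
  have rD : \rank (D Y) = rho by apply: mxrank_unit; rewrite unitmxE unitfE.
  apply: (@leq_trans (\rank (D Y))); first by rewrite rD.
  by rewrite /D -mulmxA mxrankM_maxr.
(* Multiplied by [\det (D Z)], the entries become polynomial functions vanishing on the whole orbit,
   hence on the variety by density. *)
have v_hom Z : in_variety m Z -> \det (D Z) != 0 -> v Z *m hom_mx G Z = 0.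
  move=> ZV DZ; apply/matrixP => i j.
  have pvA := polyfun_mul pdD (polyfun_mx_mul pv pA i j).
  have /eqP : \det (D Z) * (v Z *m hom_mx G Z) i j = 0.
    apply: (GX Z ZV _ pvA) => Y GY.
    have [->|DY] := eqVneq (\det (D Y)) 0; first by rewrite mul0r.
    by rewrite v_orbit // mxE mulr0.
  by rewrite mulf_eq0 (negPf DZ) => /eqP ->; rewrite mxE.
pose a Z : 'M_d0 := vec_mx (lsubmx (v Z)); pose b Z : 'M_d1 := vec_mx (rsubmx (v Z)).
have pa : polyfun_mx (@entry_fun K d0 d1) a.
  move=> i j; apply: eq_polyfun (pv 0 (lshift _ (mxvec_index i j))) => Z.
  by rewrite !mxE.
have pb : polyfun_mx (@entry_fun K d0 d1) b.
  move=> i j; apply: eq_polyfun (pv 0 (rshift _ (mxvec_index i j))) => Z.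
  by rewrite !mxE.
exists (fun Z => \det (D Z) * (\det (a Z) * \det (b Z))); split.
- by do 2!apply: polyfun_mul => //; apply: polyfun_det.
- have vG : v G = v0.
    have v0A : v0 *m hom_mx G G = 0.
      by apply/hom_mx_eq0; rewrite !mulmx1 !mul1mx.
    by rewrite /v v0A !mul0mx subr0 /D RL det1 scale1r.
  rewrite /a /b vG /v0 row_mxKl row_mxKr !mxvecK /D RL !det1 !mulr1.
  exact: oner_neq0.
move=> Z ZV; rewrite !mulf_eq0 !negb_or => /and3P[DZ aZ bZ].
have := v_hom Z ZV DZ; rewrite -[v Z]hsubmxK -[lsubmx _]vec_mxK -[rsubmx _]vec_mxK.
move=> /hom_mx_eq0[H0 H1 Hh].
have au : a Z \in unitmx by rewrite unitmxE unitfE.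
have bu : b Z \in unitmx by rewrite unitmxE unitfE.
exists (a Z), (invmx (a Z)), (b Z), (invmx (b Z)).
by split; split; rewrite ?mulmxV ?mulVmx.
Qed.

End OpenOrbit.

(** * Polynomial functions and the Zariski topology of the variety *)

Section ZariskiTopology.
Variable K : closedFieldType.
Variables (m d0 d1 : nat).
Local Notation N := (d0 * d0 + d1 * d1 + d0 * d1)%N.

Lemma polyfun_coords (i : 'I_N) :
  polyfun (@entry_fun K d0 d1) (fun X => coords X 0 i).
Proof.
have pvec a b (F : triple K d0 d1 -> 'M[K]_(a, b)) :
    polyfun_mx (@entry_fun K d0 d1) F ->
    polyfun_mx (@entry_fun K d0 d1) (fun X => mxvec (F X)).
  move=> pF k l; rewrite (ord1 k); case: (mxvec_indexP l) => u w.
  by apply: eq_polyfun (pF u w) => X; rewrite mxvecE.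
have := polyfun_mx_row (polyfun_mx_row (pvec _ _ _ (@polyfun_mx_X0 K d0 d1))
  (pvec _ _ _ (@polyfun_mx_X1 K d0 d1))) (pvec _ _ _ (@polyfun_mx_Xh K d0 d1)).
by move=> /(_ 0 i); apply: eq_polyfun => -[[M0 M1] h].
Qed.

Lemma polyfun_poly_eval (p : mpoly N K) :
  polyfun (@entry_fun K d0 d1) (fun X => poly_eval p X).
Proof.
apply: (@eq_polyfun _ _ _ (fun X => \sum_(u <- msupp p) mcoeff u p *
    \prod_i coords X 0 i ^+ u i)); first by move=> X; rewrite /poly_eval mevalE.
apply: polyfun_sum => u; apply: polyfun_mul; first exact: polyfun_cst.
by apply: polyfun_prod => i; apply/polyfun_exp/polyfun_coords.
Qed.

Lemma polyfun_ex_mpoly f : polyfun (@entry_fun K d0 d1) f ->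
  exists p : mpoly N K, forall X, f X = poly_eval p X.
Proof.
elim=> {f} [f fE|c|f g _ [p fE] _ [q gE]|f g _ [p fE] _ [q gE]]; last 3 first.
- by exists (mpolyC N c) => X; rewrite /poly_eval mevalC.
- by exists (p + q) => X; rewrite fE gE /poly_eval mevalD.
- by exists (p * q) => X; rewrite fE gE /poly_eval mevalM.
case: fE => -[i [j ->]].
- exists (mpolyX K (mnm1 (lshift _ (lshift _ (mxvec_index i j))))) => -[[M0 M1] h].
  by rewrite /poly_eval mevalXU /coords !row_mxEl mxvecE.
- exists (mpolyX K (mnm1 (lshift _ (rshift _ (mxvec_index i j))))) => -[[M0 M1] h].
  by rewrite /poly_eval mevalXU /coords row_mxEl row_mxEr mxvecE.
- exists (mpolyX K (mnm1 (rshift _ (mxvec_index i j)))) => -[[M0 M1] h].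
  by rewrite /poly_eval mevalXU /coords row_mxEr mxvecE.
Qed.

Lemma open_polyfun_neq0 f : polyfun (@entry_fun K d0 d1) f ->
  open [set M : variety K m d0 d1 | f (\val M) != 0]%classic.
Proof.
move=> /polyfun_ex_mpoly[p fE]; exists [set p]%classic.
apply/seteqP; split=> M /=; rewrite fE => pM.
  by move=> /(_ p erefl)/eqP; apply/negP.
by apply/eqP => pM0; apply: pM => _ ->.
Qed.

Lemma open_polyfun_subset (U : set (variety K m d0 d1)) M : open U -> U M ->
  exists f, [/\ polyfun (@entry_fun K d0 d1) f, f (\val M) != 0 &
    forall N, f (\val N) != 0 -> U N].
Proof.
move=> [S ->] /= SM.
have [p Sp pM] : exists2 p, S p & poly_eval p (\val M) != 0.
  apply: contrapT => nex; apply: SM => p Sp; apply/eqP.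
  by apply: contrapT => /negP pM; apply: nex; exists p.
exists (poly_eval p); split=> //; first exact: polyfun_poly_eval.
by move=> Z pZ SZ; move/eqP: pZ; apply; apply: SZ.
Qed.

Lemma GL_orbitP (M N : variety K m d0 d1) : GL_orbit M N <-> iso (\val M) (\val N).
Proof.
split=> [[g0 [g1 [u0 u1 ->]]]|/iso_ex_act[g0 [g1 [u0 u1 NE]]]].
  exact: iso_act.
by exists g0, g1.
Qed.

Lemma GL_orbit_eq (M N : variety K m d0 d1) :
  iso (\val M) (\val N) -> GL_orbit M = GL_orbit N.
Proof.
move=> MN; apply/seteqP; split=> L /GL_orbitP ML; apply/GL_orbitP.
  exact: iso_trans (iso_sym MN) ML.
exact: iso_trans MN ML.
Qed.

End ZariskiTopology.

Theorem mainTheorem2 (K : closedFieldType) (m d0 d1 : nat) (hm : (1 <= m)%N) :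
  exists! O : set (variety K m d0 d1),
    (exists M : variety K m d0 d1, O = GL_orbit M) /\ dense O.
Proof.
have [G [GV GX]] := has_generic_all K d0 d1 hm.
pose M : variety K m d0 d1 := exist _ G GV.
have [q [pq qG qZ]] := dense_orbit_open GX.
exists (GL_orbit M); split.
  split; first by exists M.
  move=> U [N UN] oU; have [f [pf fN fU]] := open_polyfun_subset oU UN.
  (* The closure only provides a triple in affine space; isomorphism with [G] places it in the
     variety. *)
  have [Y GY fY] := zclosure_neq0 (GX _ (valP N)) pf fN.
  have YV : in_variety m Y by rewrite -(iso_in_varietyE _ GY).
  by exists (exist _ Y YV); split; [apply: fU|apply/GL_orbitP].
move=> _ [[M' ->] dM'].
(* The set [q != 0] is open, contains [M] and lies in the orbit of [M]; another dense orbit must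
   meet it and therefore coincides with that orbit. *)
have [|N [qN M'N]] := dM' _ _ (@open_polyfun_neq0 K m d0 d1 _ pq).
  by exists M.
move/GL_orbitP in M'N; rewrite (GL_orbit_eq M'N); apply: GL_orbit_eq.
exact: qZ (valP N) qN.
Qed.
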